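(* Let $G$ be a connected real or complex Lie group and $N\subset G$ a connected normal Lie subgroup (not necessarily closed), with Lie algebras $\mathfrak g$ and $\mathfrak n$. There is a bijection between the set of bundles of reduced-group orbits (over all $G$-orbits $B\subset\mathfrak n^*$) and the set of coadjoint orbits of $G$ on $\mathfrak g^*$.
   Context: $G$ acts on $\mathfrak g^*$ by $\langle\operatorname{Ad}^*_g\beta,\xi\rangle=\langle\beta,\operatorname{Ad}_g\xi\rangle$ and on $\mathfrak n^*$ by $\langle g\cdot\mu,y\rangle=\langle\mu,\operatorname{Ad}_gy\rangle$, $y\in\mathfrak n$. For $\hat\nu\in\mathfrak n^*$: $G_{\hat\nu}=\{g\in G:g\cdot\hat\nu=\hat\nu\}$ with Lie algebra $\mathfrak g_{\hat\nu}=\{\xi\in\mathfrak g:\langle\hat\nu,[\xi,\mathfrak n]\rangle=0\}$, and $\mathfrak n_{\hat\nu}=\mathfrak n\cap\mathfrak g_{\hat\nu}$. The group $G_{\hat\nu}$ acts on $\mathfrak g_{\hat\nu}^*$ by its coadjoint action. An element $\hat\tau\in\mathfrak g_{\hat\nu}^*$ is called a $\mathfrak g_{\hat\nu}^*$-extension of $\hat\nu$ if $\hat\tau|\mathfrak n_{\hat\nu}=\hat\nu|\mathfrak n_{\hat\nu}$ (equivalently, there is $\hat\sigma\in\mathfrak g^*$ with $\hat\sigma|\mathfrak n=\hat\nu$ and $\hat\sigma|\mathfrak g_{\hat\nu}=\hat\tau$). Let $B$ be a $G$-orbit in $\mathfrak n^*$. A bundle of reduced-group orbits over $B$ is a bundle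 $p:P\to B$ such that for each $\hat\nu\in B$ the fibre $F_P(\hat\nu)=p^{-1}(\hat\nu)$ is a $G_{\hat\nu}$-orbit in $\mathfrak g_{\hat\nu}^*$ passing through some $\mathfrak g_{\hat\nu}^*$-extension of $\hat\nu$, and such that for $g\in G$ and $\hat\tau\in F_P(\hat\nu)$ the element $g.\hat\tau\in\mathfrak g_{g\cdot\hat\nu}^*$ defined by $\langle g.\hat\tau,\xi'\rangle=\langle\hat\tau,\operatorname{Ad}_g\xi'\rangle$, $\xi'\in\mathfrak g_{g\cdot\hat\nu}$, belongs to $F_P(g\cdot\hat\nu)$. Thus $P$ is the disjoint union of the fibres $F_P(\hat\nu)$, and $G$ acts transitively on $P$. Its smooth structure is that of $G\times_{G_\nu}(G_\nu/G_{\nu\tau})$, for $\nu\in B$, $\tau\in F_P(\nu)$ and $G_{\nu\tau}$ the isotropy group of $\tau$ in $G_\nu$; so a bundle of reduced-group orbits is determined by $B$ and the family of fibres. *)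

(* Defs.v *)
From HB Require Import structures.
From mathcomp Require Import all_boot all_order all_algebra.
From mathcomp Require Import all_classical all_reals all_analysis.
From mathcomp Require Import complex.

Set Implicit Arguments.
Unset Strict Implicit.
Unset Printing Implicit Defensive.

Import Order.TTheory GRing.Theory Num.Theory.
Import numFieldNormedType.Exports.

Local Open Scope classical_set_scope.
Local Open Scope ring_scope.

Variant ground := RealNumbers | ComplexNumbers.

Definition scalars (R : realType) (k : ground) : numFieldType :=
  match k with
  | RealNumbers => R : numFieldType
  | ComplexNumbers => R[i]%C : numFieldType
  end.

Section Smooth.
Context {K : numFieldType} {V W : normedModType K}.

(* Meaningful for U open.  Differentiability is K-linear: when V is finite
   dimensional, [smooth] means C^oo for real scalars and holomorphic for
   complex scalars. *)
Fixpoint Ck (k : nat) (U : set V) (f : V -> W) : Prop :=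
  match k with
  | 0 => forall x, U x -> {for x, continuous f}
  | k'.+1 => (forall x, U x -> differentiable f x) /\
             (forall v, Ck k' U ('D_v f))
  end.

Definition smooth (U : set V) (f : V -> W) : Prop := forall k, Ck k U f.

End Smooth.

(* A homeomorphism from an open subset of T onto an open subset of K^n; the
   values of chart_map and chart_inv outside these two sets are irrelevant. *)
Record chart (K : numFieldType) (n : nat) (T : topologicalType) := Chart {
  chart_dom : set T;
  chart_map :> T -> 'rV[K]_n;
  chart_inv : 'rV[K]_n -> T;
  chart_dom_open : open chart_dom;
  chart_cod_open : open (chart_map @` chart_dom);
  chart_mapK : forall x, chart_dom x -> chart_inv (chart_map x) = x;
  chart_map_cont : forall x, chart_dom x -> {for x, continuous chart_map};
  chart_inv_cont :
    forall v, (chart_map @` chart_dom) v -> {for v, continuous chart_inv}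
}.

Definition chart_cod K n T (c : chart K n T) : set 'rV[K]_n :=
  c @` chart_dom c.

HB.mixin Record isManifold (K : numFieldType) (n : nat) M
    of Topological M := {
  atlas : set (chart K n M);
  manifold_hausdorff : hausdorff_space M;
  manifold_second_countable : @second_countable M;
  atlas_cover : forall x : M, exists2 c, atlas c & chart_dom c x;
  atlas_compat : forall c d, atlas c -> atlas d ->
    smooth (c @` (chart_dom c `&` chart_dom d)) (d \o chart_inv c)
}.

#[short(type="manifoldType")]
HB.structure Definition Manifold (K : numFieldType) (n : nat) :=
  {M of isManifold K n M & Topological M}.

Section ManifoldTheory.
Context {K : numFieldType}.

Definition smooth_map {m n} {M : manifoldType K m} {N : manifoldType K n}
    (f : M -> N) : Prop :=
  continuous f /\
  forall (c : chart K m M) (d : chart K n N), atlas c -> atlas d ->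
    smooth (chart_cod c `&` [set v | chart_dom d (f (chart_inv c v))])
           (d \o f \o chart_inv c).

(* The same notion on the product manifold M1 x M2, with its product charts. *)
Definition smooth_map2 {m1 m2 n} {M1 : manifoldType K m1}
    {M2 : manifoldType K m2} {N : manifoldType K n}
    (f : M1 -> M2 -> N) : Prop :=
  continuous (fun p : M1 * M2 => f p.1 p.2) /\
  forall (c1 : chart K m1 M1) (c2 : chart K m2 M2) (d : chart K n N),
    atlas c1 -> atlas c2 -> atlas d ->
    smooth [set v : 'rV[K]_m1 * 'rV[K]_m2 | [/\ chart_cod c1 v.1,
              chart_cod c2 v.2 &
              chart_dom d (f (chart_inv c1 v.1) (chart_inv c2 v.2))]]
           (fun v => d (f (chart_inv c1 v.1) (chart_inv c2 v.2))).

(* A chosen chart around each point; it identifies T_x M with K^n. *)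
Definition chart_at {n} {M : manifoldType K n} (x : M) : chart K n M :=
  s2val (cid2 (atlas_cover x)).

Definition tangent_map {m n} {M : manifoldType K m} {N : manifoldType K n}
    (f : M -> N) (x : M) : {linear 'rV[K]_m -> 'rV[K]_n} :=
  'd (chart_at (f x) \o f \o chart_inv (chart_at x)) (chart_at x x).

End ManifoldTheory.

HB.mixin Record Manifold_isLieGroup (K : numFieldType) (n : nat) G
    of Group G & Manifold K n G := {
  smooth_mulg : smooth_map2 (fun x y : G => (x * y)%g);
  smooth_invg : smooth_map (fun x : G => (x^-1)%g)
}.

#[short(type="lieGroupType")]
HB.structure Definition LieGroup (K : numFieldType) (n : nat) :=
  {G of Manifold_isLieGroup K n G & Group G & Manifold K n G}.

(* An immersed (not necessarily closed) subgroup, given by its inclusion; its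
   own topology and smooth structure need not be induced by those of G. *)
Record lieSubgroup (K : numFieldType) (n : nat) (G : lieGroupType K n) :=
    LieSubgroup {
  sub_dim : nat;
  sub_group :> lieGroupType K sub_dim;
  sub_incl : sub_group -> G;
  sub_inclM : {morph sub_incl : x y / (x * y)%g};
  sub_incl_inj : injective sub_incl;
  sub_incl_smooth : smooth_map sub_incl;
  sub_incl_immersion : forall x, injective (tangent_map sub_incl x)
}.

Definition normal_subgroup K n (G : lieGroupType K n) (N : lieSubgroup G) :=
  forall (g : G) (x : N),
    range (@sub_incl _ _ _ N) (g * sub_incl x * g^-1)%g.

(* The Lie algebra g = T_1 G is identified with 'rV[K]_n by chart_at 1.  Matrices
   act on row vectors from the right, so Ad_mx (g * h) = Ad_mx h *m Ad_mx g. *)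
Section LieAlgebra.
Context {K : numFieldType} {n : nat} {G : lieGroupType K n}.
Implicit Types (g : G) (xi eta : 'rV[K]_n).

Definition Ad_mx g : 'M[K]_n :=
  lin1_mx (tangent_map (fun x : G => (g * x * g^-1)%g) 1%g).

Definition Ad g xi : 'rV[K]_n := xi *m Ad_mx g.

(* ad is the derivative of Ad at the identity. *)
Definition ad_mx xi : 'M[K]_n :=
  'd ((Ad_mx : G -> 'M[K]_n) \o chart_inv (chart_at (1%g : G)))
     (chart_at (1%g : G) 1%g) xi.

Definition bracket xi eta : 'rV[K]_n := eta *m ad_mx xi.

Definition coadjoint g (beta : 'Hom('rV[K]_n, K^o)) : 'Hom('rV[K]_n, K^o) :=
  linfun (fun xi => beta (Ad g xi)).

Definition coadjoint_orbit (O : set 'Hom('rV[K]_n, K^o)) : Prop :=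
  exists beta, O = range (coadjoint^~ beta).

End LieAlgebra.

Definition dual (K : fieldType) (V : vectType K) (U : {vspace V}) :=
  'Hom(subvs_of U, K^o).

Section ReducedGroupOrbits.
Context {K : numFieldType} {n : nat} {G : lieGroupType K n}.
Variable N : lieSubgroup G.
Implicit Types (g : G) (U : {vspace 'rV[K]_n}).

Definition lie_sub : {vspace 'rV[K]_n} :=
  limg (linfun (tangent_map (@sub_incl _ _ _ N) 1%g)).

(* The functional xi' |-> <tau, Ad_g xi'> on U'.  It is used only when Ad_g
   maps U' into U, and then vsproj U just views Ad_g xi' as an element of U;
   likewise for the other occurrences of vsproj below. *)
Definition dual_act g U U' (tau : dual U) : dual U' :=
  linfun (fun xi : subvs_of U' => tau (vsproj U (Ad g (vsval xi)))).

Definition act (g : G) (mu : dual lie_sub) : dual lie_sub :=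
  dual_act g lie_sub mu.

Definition stab (nu : dual lie_sub) : set G := [set g | act g nu = nu].

Definition stab_alg (nu : dual lie_sub) : {vspace 'rV[K]_n} :=
  lker (linfun (fun xi : 'rV[K]_n =>
    linfun (fun y : subvs_of lie_sub =>
      nu (vsproj lie_sub (bracket (G := G) xi (vsval y)))) : dual lie_sub)).

Lemma stab_algP (nu : dual lie_sub) (xi : 'rV[K]_n) :
  reflect (forall y, y \in lie_sub ->
             nu (vsproj lie_sub (bracket (G := G) xi y)) = 0)
          (xi \in stab_alg nu).
Proof.
pose h (xi : 'rV[K]_n) (y : subvs_of lie_sub) : K^o :=
  nu (vsproj lie_sub (bracket (G := G) xi (vsval y))).
have h2 z : linear (h z).
  by move=> a y y'; rewrite /h /bracket linearP mulmxDl -scalemxAl !linearP.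
have hE z : linfun (h z) =1 h z.
  pose L := GRing.isLinear.Build K (subvs_of lie_sub) K^o _ (h z) (h2 z).
  pose hL : {linear subvs_of lie_sub -> K^o} := HB.pack (h z) L.
  exact: (lfunE hL).
have H1 : linear (fun z => linfun (h z) : dual lie_sub).
  move=> a z z'; apply/lfunP => y; rewrite add_lfunE scale_lfunE !hE /h.
  by rewrite /bracket /ad_mx linearP mulmxDr -scalemxAr !linearP.
pose L := GRing.isLinear.Build K 'rV[K]_n (dual lie_sub) _
  (fun z => linfun (h z) : dual lie_sub) H1.
pose H : {linear 'rV[K]_n -> dual lie_sub} :=
  HB.pack (fun z => linfun (h z) : dual lie_sub) L.
have HE z : linfun (fun z => linfun (h z) : dual lie_sub) z = linfun (h z).
  exact: (lfunE H).
apply: (iffP idP) => [|xiP].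
  rewrite /stab_alg memv_ker HE => /eqP h0 y yn.
  by have := congr1 (fun u : dual lie_sub => u (vsproj lie_sub y)) h0;
    rewrite zero_lfunE hE /h vsprojK.
rewrite /stab_alg memv_ker HE; apply/eqP/lfunP => y.
by rewrite zero_lfunE hE; apply: xiP; apply: subvsP.
Qed.

Definition sub_stab_alg (nu : dual lie_sub) : {vspace 'rV[K]_n} :=
  (lie_sub :&: stab_alg nu)%VS.

Definition extension (nu : dual lie_sub) (tau : dual (stab_alg nu)) : Prop :=
  forall y, y \in sub_stab_alg nu ->
    tau (vsproj (stab_alg nu) y) = nu (vsproj lie_sub y).

Definition reduced_orbit (nu : dual lie_sub) (tau : dual (stab_alg nu)) :
    set (dual (stab_alg nu)) :=
  [set dual_act h (stab_alg nu) tau | h in stab nu].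

Definition total_dual := {nu : dual lie_sub & dual (stab_alg nu)}.

Definition fibre (P : set total_dual) (nu : dual lie_sub) :
    set (dual (stab_alg nu)) :=
  [set tau | P (existT _ nu tau)].
Arguments fibre : clear implicits.

(* A bundle is the pair (B, P); its projection is the first component map,
   and its smooth structure is determined by B and the fibres. *)
Definition orbit_bundle (BP : set (dual lie_sub) * set total_dual) : Prop :=
  let: (B, P) := BP in
  [/\ exists nu, B = range (act^~ nu),
      forall t, P t -> B (projT1 t),
      forall nu, B nu -> exists2 tau : dual (stab_alg nu),
        extension tau & fibre P nu = reduced_orbit tau &
      forall (g : G) nu (tau : dual (stab_alg nu)), fibre P nu tau ->
        fibre P (act g nu) (dual_act g (stab_alg (act g nu)) tau)].

End ReducedGroupOrbits.

(* Main.v *)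
Require Import Defs.
From HB Require Import structures.
From mathcomp Require Import all_boot all_order all_algebra.
From mathcomp Require Import all_classical all_reals all_analysis.
From mathcomp Require Import complex lra ring.

(* To beta in g* attach nu = beta|n and tau = beta|g_nu.  This assignment is
   G-equivariant, and its values are exactly the pairs (nu, tau) with tau an
   extension of nu.  A bundle of reduced-group orbits amounts to one G-orbit of
   such pairs, so its preimage is a union of coadjoint orbits; the point is that
   it is a single one, i.e. that beta, beta' with the same (nu, tau) are
   conjugate.  Now beta' - beta vanishes on g_nu, the right kernel of
   (y, xi) |-> nu([y, xi]) on n x g, so beta' - beta = beta([y, .]) for some y
   in n; as beta' - beta also vanishes on n, the square of ad y kills beta,
   whence beta o Ad(exp y) = beta + beta o ad y = beta'.

   Instead of the exponential map, we use limits of Ad(x_m)^m with x_m the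
   element of coordinates y/m: for small y the powers x_m^m stay in a compact
   coordinate ball, so the limit of beta o Ad(x_m^m) is attained at some group
   element, and finitely many iterations reach every y.

   That n is Ad-stable needs an argument, as conjugation is not known a priori
   to be continuous for the topology of N: since N is second countable, among
   the uncountably many conjugates of a curve through 1 two are close in N. *)

(** The bracket is only given as the derivative of Ad in one chart, so its skew-symmetry must be
    proved: differentiating x y = (x y x^-1) x writes Ad, hence the bracket, by partial derivatives
    of the multiplication, and skew-symmetry becomes the symmetry of second derivatives. It is
    needed because duality produces [., y], with y in the right slot, whereas the shift uses ad y.

    Approximating beta + beta o ad y by conjugates of beta only puts it in the closure of an orbit,
    and orbits need not be closed. This is why the powers are confined to a compact coordinate ball,
    at the price of a short step. The step length depends on y alone, not on the functional, so that
    the same step can be repeated from the shifted functional.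

    For Ad-stability, let two points of the curve with tangent y have close conjugates. Their
    quotient p and its conjugate q are both near 1 in N, and the coordinates of p are nearly a
    nonzero multiple of y. Comparing first-order expansions of q and of the conjugate of p puts Ad_g
    of the tangent within a small relative error of n, a finite-dimensional subspace; the error is
    arbitrary. *)

Set Implicit Arguments.
Unset Strict Implicit.
Unset Printing Implicit Defensive.

Import Order.TTheory GRing.Theory Num.Theory.
Import numFieldNormedType.Exports.

Local Open Scope classical_set_scope.
Local Open Scope ring_scope.

(* The common features of K = R and K = C which are used: norms have values in
   the real line inside K, and closed balls are compact.  Norms are then read as
   elements of R, where the order is total. *)
Record real_norm (R : realType) (K : numFieldType) := RealNorm {
  emb : {rmorphism R -> K};
  emb_le : {mono emb : x y / x <= y};
  emb_nneg : forall x : K, 0 <= x -> exists r, x = emb r;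
  unit_ball_compact : compact [set x : K | `|x| <= 1]
}.

(** * Norms with values in R *)

Section RealNorm.
Context {R : realType} {K : numFieldType} (S : real_norm R K).
Local Notation "r %:K" := (emb S r) (at level 2, format "r %:K").

Definition rnorm {V : normedModType K} (v : V) : R :=
  sval (cid (emb_nneg S (normr_ge0 v))).

Local Notation nr := rnorm.

Lemma nrE {V : normedModType K} (v : V) : (nr v)%:K = `|v|.
Proof. by rewrite /rnorm; case: cid. Qed.

Lemma emb_inj : injective (emb S).
Proof. by move=> x y xy; apply/eqP; rewrite eq_le -!(emb_le S) xy lexx. Qed.

Lemma emb_lt x y : (x%:K < y%:K) = (x < y).
Proof. by rewrite !lt_def (emb_le S) (inj_eq emb_inj). Qed.

Lemma emb_ge0 x : (0 <= x%:K) = (0 <= x).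
Proof. by rewrite -(rmorph0 (emb S)) (emb_le S). Qed.

Lemma emb_gt0 x : (0 < x%:K) = (0 < x).
Proof. by rewrite -(rmorph0 (emb S)) emb_lt. Qed.

Lemma emb_norm x : `|x%:K| = `|x|%:K.
Proof.
have [x0|x0] := leP 0 x; first by rewrite !ger0_norm ?emb_ge0.
by rewrite ltr0_norm ?ltr0_norm ?rmorphN // -(rmorph0 (emb S)) emb_lt.
Qed.

Lemma emb_pos (x : K) : 0 < x -> exists2 r, 0 < r & x = r%:K.
Proof.
by move=> x0; have [r xr] := emb_nneg S (ltW x0); exists r; rewrite // -emb_gt0 -xr.
Qed.

Section Norm.
Context {V : normedModType K}.
Implicit Types v w : V.

Lemma nr_ge0 v : 0 <= nr v.
Proof. by rewrite -emb_ge0 nrE. Qed.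

Lemma nrD v w : nr (v + w) <= nr v + nr w.
Proof. by rewrite -(emb_le S) rmorphD !nrE ler_normD. Qed.

Lemma nrN v : nr (- v) = nr v.
Proof. by apply: emb_inj; rewrite !nrE normrN. Qed.

Lemma nrBC v w : nr (v - w) = nr (w - v).
Proof. by rewrite -nrN opprB. Qed.

Lemma nrB v w : nr (v - w) <= nr v + nr w.
Proof. by rewrite -[nr w]nrN nrD. Qed.

Lemma nr0 : nr (0 : V) = 0.
Proof. by apply: emb_inj; rewrite nrE normr0 rmorph0. Qed.

Lemma nr0_eq0 v : nr v = 0 -> v = 0.
Proof. by move=> v0; apply/normr0_eq0; rewrite -nrE v0 rmorph0. Qed.

Lemma nr_gt0 v : v != 0 -> 0 < nr v.
Proof. by rewrite -normr_gt0 -nrE emb_gt0. Qed.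

Lemma nrZ (a : K) v : nr (a *: v) = nr (a : K^o) * nr v.
Proof. by apply: emb_inj; rewrite rmorphM !nrE normrZ. Qed.

Lemma nr_tri (u v w : V) : nr (u - w) <= nr (u - v) + nr (v - w).
Proof. by apply: le_trans (nrD _ _); rewrite addrA subrK. Qed.

Lemma nr_sum (I : Type) (s : seq I) (P : pred I) (f : I -> V) :
  nr (\sum_(i <- s | P i) f i) <= \sum_(i <- s | P i) nr (f i).
Proof.
by elim/big_ind2: _ => [|x1 x2 y1 y2 h1 h2|//]; rewrite ?nr0 // (le_trans (nrD _ _)) ?lerD.
Qed.

Lemma nearP_nr (x : V) (P : V -> Prop) :
  (\forall y \near x, P y) <->
  exists2 d : R, 0 < d & forall y, nr (y - x) < d -> P y.
Proof.
split=> [/nbhs_normP[d /= d0 dP]|[d d0 dP]].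
  have [r r0 dr] := emb_pos d0; exists r => // y yx; apply: dP => /=.
  by rewrite dr -nrE emb_lt nrBC.
apply/nbhs_normP; exists d%:K => /=; first by rewrite emb_gt0.
by move=> y /=; rewrite -nrE emb_lt nrBC => /dP.
Qed.

End Norm.

Lemma nr_emb x : nr (x%:K : K^o) = `|x|.
Proof. by apply: emb_inj; rewrite nrE emb_norm. Qed.

Lemma nr_pair {V W : normedModType K} (v : V) (w : W) :
  nr (v, w) = Num.max (nr v) (nr w).
Proof.
apply: emb_inj; rewrite nrE prod_normE /= -!nrE; case: leP => [h|h].
  by rewrite max_r // (emb_le S).
by rewrite max_l // (emb_le S) ltW.
Qed.

Lemma nr_mx_entry {m n} (A : 'M[K]_(m, n)) i j : nr (A i j : K^o) <= nr A.
Proof.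
rewrite -(emb_le S) !nrE [X in _ <= X]/Num.norm /= mx_normE.
by rewrite -[leLHS]nngE num_le; exact: (le_bigmax _ _ (i, j)).
Qed.

Section Maps.
Context {V W : normedModType K}.

Lemma continuous_atP_nr (f : V -> W) x : {for x, continuous f} <->
  forall e : R, 0 < e -> exists2 d : R, 0 < d & forall y, nr (y - x) < d -> nr (f y - f x) < e.
Proof.
split=> [fx e e0|fx].
  move/cvgrPdist_lt: fx => /(_ e%:K); rewrite emb_gt0 => /(_ e0).
  by move=> /nearP_nr[d d0 dP]; exists d => // y /dP; rewrite -nrE emb_lt nrBC.
apply/cvgrPdist_lt => e /emb_pos[r r0 ->]; apply/nearP_nr.
by have [d d0 dP] := fx r r0; exists d => // y /dP; rewrite -nrE emb_lt nrBC.
Qed.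

Lemma diff_nr (f : V -> W) x : differentiable f x -> forall e : R, 0 < e ->
  exists2 d : R, 0 < d &
    forall h, nr h < d -> nr (f (x + h) - f x - 'd f x h) <= e * nr h.
Proof.
move=> /diff_locallyP[_ /eqaddoP fx] e e0.
have /fx /nearP_nr[d d0 dP] : 0 < e%:K by rewrite emb_gt0.
exists d => // h hd; move: (dP h); rewrite subr0 => /(_ hd).
have -> : f (x + h) - f x - 'd f x h = f (h + x) - (f x + 'd f x h).
  by rewrite opprD addrA [x + h]addrC.
by rewrite -!nrE -rmorphM (emb_le S).
Qed.

Lemma diff_nrP (f : V -> W) x (df : {linear V -> W}) : continuous df ->
  (forall e : R, 0 < e -> exists2 d : R, 0 < d &
    forall h, nr h < d -> nr (f (x + h) - f x - df h) <= e * nr h) ->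
  differentiable f x /\ 'd f x = df :> (V -> W).
Proof.
move=> cdf fx.
have H : f \o shift x = cst (f x) + df +o_ 0 id.
  apply/eqaddoP => e /emb_pos[r r0 ->]; apply/nearP_nr.
  have [d d0 dP] := fx r r0; exists d => // h; rewrite subr0 => /dP.
  have -> : f (x + h) - f x - df h = f (h + x) - (f x + df h).
    by rewrite opprD addrA [x + h]addrC.
  by rewrite -!nrE -rmorphM (emb_le S).
have dE := diff_unique cdf H; split=> //; apply/diff_locallyP; rewrite dE; split=> //.
Qed.

Lemma linear_nr (f : {linear V -> W}) : continuous f ->
  exists2 c : R, 0 < c & forall v, nr (f v) <= c * nr v.
Proof.
move=> /linear_lipschitz[k /emb_pos[c c0 ->] kP]; exists c => // v.
by rewrite -(emb_le S) rmorphM !nrE.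
Qed.

Lemma diff_lipschitz (f : V -> W) x : differentiable f x ->
  exists2 C : R, 0 < C & \forall y \near x, nr (f y - f x) <= C * nr (y - x).
Proof.
move=> df; have [d d0 dP] := diff_nr df ltr01.
have [C C0 CP] := linear_nr (diff_continuous df).
exists (1 + C); first by rewrite addr_gt0.
apply/nearP_nr; exists d => // y /dP; rewrite [x + _]addrC subrK => H.
rewrite mulrDl; apply: le_trans (lerD H (CP (y - x))).
by apply: le_trans (nrD _ _); rewrite subrK.
Qed.

Lemma bounded_linear_continuous (f : {linear V -> W}) (c : R) :
  (forall v, nr (f v) <= c * nr v) -> continuous f.
Proof.
move=> fc x; apply/continuous_atP_nr => e e0.
have c1 : 0 < `|c| + 1 by rewrite ltr_pwDr.
exists (e / (`|c| + 1)); first by rewrite divr_gt0.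
move=> y; rewrite ltr_pdivlMr // => yx; rewrite -linearB (le_lt_trans (fc _)) //.
apply: le_lt_trans yx; rewrite mulrC ler_wpM2l ?nr_ge0 //.
by rewrite (le_trans (ler_norm _)) // lerDl.
Qed.

End Maps.

(** Linearity is a hypothesis on a bare function because the lemma is applied to expressions such as
    ['d mul (u, v) (0, w) - w], where only values on basis vectors are controlled. The factor n
    counts the coordinates. *)
Lemma rV_basis_bound {n} {W : normedModType K} (f : 'rV[K]_n -> W) (c : R) :
  linear f -> (forall i, nr (f (delta_mx 0 i)) <= c) ->
  forall v, nr (f v) <= n%:R * c * nr v.
Proof.
move=> lf fc v.
pose L := GRing.isLinear.Build K 'rV[K]_n W _ f lf.
pose fL : {linear 'rV[K]_n -> W} := HB.pack f L.
rewrite -[f]/(fL : _ -> _) [in X in X <= _](row_sum_delta v) linear_sum.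
apply: le_trans (nr_sum _ _ _) _.
rewrite (_ : n%:R * c * nr v = \sum_(i < n) c * nr v); last first.
  by rewrite sumr_const card_ord -mulrA mulr_natl.
by apply: ler_sum => i _; rewrite linearZ nrZ mulrC ler_pM ?nr_ge0 ?nr_mx_entry //; exact: fc.
Qed.

Lemma mx_linear_bounded {m n} {W : normedModType K} (f : {linear 'M[K]_(m, n) -> W}) :
  exists2 c : R, 0 < c & forall A, nr (f A) <= c * nr A.
Proof.
pose c := \sum_(i < m) \sum_(j < n) nr (f (delta_mx i j)).
have c0 : 0 <= c by do 2!apply: sumr_ge0 => ? _; exact: nr_ge0.
exists (c + 1) => [|A]; first by rewrite ltr_wpDl.
apply: le_trans (_ : c * nr A <= _); last by rewrite ler_wpM2r ?nr_ge0 // lerDl.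
rewrite [in X in X <= _](matrix_sum_delta A) linear_sum mulr_suml.
apply: le_trans (nr_sum _ _ _) (ler_sum _ _) => i _; rewrite linear_sum mulr_suml.
apply: le_trans (nr_sum _ _ _) (ler_sum _ _) => j _; rewrite linearZ nrZ mulrC.
by rewrite ler_wpM2l ?nr_ge0 ?nr_mx_entry.
Qed.

Lemma mx_linear_continuous {m n} {W : normedModType K} (f : {linear 'M[K]_(m, n) -> W}) :
  continuous f.
Proof. by have [c _ cP] := mx_linear_bounded f; apply: bounded_linear_continuous cP. Qed.

End RealNorm.

Ltac row_ring := apply/rowP => ?; rewrite !mxE; ring.

(** * Mean value inequality and symmetry of second derivatives *)

Section MeanValue.
Context {R : realType} {K : numFieldType} (S : real_norm R K).
Local Notation "r %:K" := (emb S r) (at level 2, format "r %:K").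
Local Notation nr := (rnorm S).

Section Curves.
Context {m : nat}.
Local Notation W := 'rV[K]_m.
Implicit Types g : R -> W.

(** The parameter stays real also over the complex numbers: the mean value argument uses the order
    of [0, 1]. *)
Definition real_derivative g (t : R) (w : W) :=
  forall e : R, 0 < e -> exists2 d : R, 0 < d &
    forall h, `|h| < d -> nr (g (t + h) - g t - h%:K *: w) <= e * `|h|.

Lemma real_derivativeB g1 g2 t w1 w2 :
  real_derivative g1 t w1 -> real_derivative g2 t w2 ->
  real_derivative (fun s => g1 s - g2 s) t (w1 - w2).
Proof.
move=> d1 d2 e e0; have e2 : 0 < e / 2 by rewrite divr_gt0.
have [r1 r10 H1] := d1 _ e2; have [r2 r20 H2] := d2 _ e2.
exists (Num.min r1 r2) => [|h]; first by rewrite lt_min r10.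
rewrite lt_min => /andP[/H1 {}H1 /H2 {}H2].
rewrite [e]splitr mulrDl (le_trans _ (lerD H1 H2)) //.
apply: le_trans (nrB _ _ _); rewrite le_eqVlt; apply/orP; left.
by apply/eqP; congr (rnorm _ _); row_ring.
Qed.

Lemma real_derivativeZ t (w : W) : real_derivative (fun s => s%:K *: w) t w.
Proof.
move=> e e0; exists 1 => // h _.
have -> : (t + h)%:K *: w - t%:K *: w - h%:K *: w = 0 by row_ring.
by rewrite nr0 mulr_ge0 // ltW.
Qed.

(** The radius [d] depends on t, so the local bounds are chained by a supremum: the bound propagates
    to c = sup E from the left and then past c, unless c = 1. *)
Lemma mean_value_aux g (L : R) : 0 <= L ->
  (forall t, 0 <= t <= 1 -> exists2 d : R, 0 < d &
    forall h, `|h| < d -> nr (g (t + h) - g t) <= L * `|h|) ->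
  nr (g 1 - g 0) <= L.
Proof.
move=> L0 gL.
pose E := [set t : R | 0 <= t <= 1 /\
                       forall s, 0 <= s <= t -> nr (g s - g 0) <= L * s].
have E0 : E 0.
  split; first by apply/andP; split; lra.
  by move=> s; rewrite -eq_le => /eqP <-; rewrite subrr nr0 mulr0.
have supE : has_sup E by split; [exists 0|exists 1 => t [/andP[]]].
set c := sup E.
have c0 : 0 <= c by apply: ub_le_sup => //; case: supE.
have c1 : c <= 1 by apply: ge_sup; [exists 0|move=> t [/andP[]]].
have [|d d0 gc] := gL c; first by rewrite c0 c1.
have below s : 0 <= s -> s < c -> nr (g s - g 0) <= L * s.
  move=> s0 sc; have [|t [_ tP]] := @sup_adherent _ E (c - s) _ supE.
    by rewrite subr_gt0.
  by rewrite -/c subKr => st; apply: tP; rewrite s0 ltW.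
have at_c : nr (g c - g 0) <= L * c.
  have [t [/andP[t0 t1] tP]] := @sup_adherent _ E d d0 supE; rewrite -/c => ct.
  have tc : t <= c by apply: ub_le_sup; [case: supE|split=> //; rewrite t0].
  have H : nr (g t - g c) <= L * `|t - c|.
    by have := gc (t - c); rewrite [c + _]addrC subrK; apply; rewrite ler0_norm; lra.
  have H2 : nr (g t - g 0) <= L * t by apply: tP; rewrite t0 lexx.
  move: H; rewrite ler0_norm ?subr_le0 // => H.
  have := nr_tri S (g c) (g t) (g 0); rewrite (nrBC S (g c) (g t)); lra.
have above s : 0 <= s -> s < c + d -> nr (g s - g 0) <= L * s.
  move=> s0 scd; have [sc|cs|->] := ltgtP s c => //; first exact: below.
  have H : nr (g s - g c) <= L * `|s - c|.
    by have := gc (s - c); rewrite [c + _]addrC subrK; apply; rewrite ger0_norm; lra.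
  move: H; rewrite ger0_norm ?subr_ge0 ?(ltW cs) // => H.
  have := nr_tri S (g s) (g c) (g 0); lra.
suff c1E : c = 1 by rewrite -[leRHS]mulr1 -[X in _ * X]c1E -[X in g X]c1E.
apply/eqP; rewrite eq_le c1 leNgt /=; apply/negP => lt_c1.
(* Half of [d] keeps t strictly inside the interval where [above] applies. *)
pose t := Num.min 1 (c + d / 2).
have tE : E t.
  split; first by rewrite le_min ler01 ge_min lexx /= addr_ge0 // divr_ge0 // ltW.
  move=> s /andP[s0]; rewrite le_min => /andP[_ st]; apply: above => //; lra.
have : t <= c by apply: ub_le_sup => //; case: supE.
rewrite leNgt lt_min lt_c1 /=; lra.
Qed.

(** Subtracting the line s w leaves a curve with derivative [g' s - w], of norm at most M. The slack
    e pays for the error term in the definition of the derivative. *)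
Lemma mean_value g (g' : R -> W) (w : W) (M : R) : 0 <= M ->
  (forall t, 0 <= t <= 1 -> real_derivative g t (g' t)) ->
  (forall t, 0 <= t <= 1 -> nr (g' t - w) <= M) ->
  nr (g 1 - g 0 - w) <= M.
Proof.
move=> M0 dg bg; apply/ler_addgt0Pr => e e0.
have := @mean_value_aux (fun s => g s - s%:K *: w) (M + e).
have -> : g 1 - 1%:K *: w - (g 0 - 0%:K *: w) = g 1 - g 0 - w.
  by rewrite rmorph1 rmorph0; row_ring.
apply; first by rewrite addr_ge0 // ltW.
move=> t t01; have /(_ e e0)[d d0 dP] := real_derivativeB (dg t t01) (real_derivativeZ t w).
exists d => // h /dP H.
have := nrD S (g (t + h) - (t + h)%:K *: w - (g t - t%:K *: w) - h%:K *: (g' t - w))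
              (h%:K *: (g' t - w)).
rewrite subrK => /le_trans -> //; rewrite nrZ nr_emb.
have := bg t t01; have := normr_ge0 h; nra.
Qed.

Lemma real_derivative_line {V : normedModType K} (f : V -> W) (x q : V) t :
  differentiable f (x + t%:K *: q) ->
  real_derivative (fun s => f (x + s%:K *: q)) t ('d f (x + t%:K *: q) q).
Proof.
move=> df e e0; have c0 : 0 < nr q + 1 by rewrite ltr_wpDl ?nr_ge0.
have [|d d0 dP] := diff_nr S df (e := e / (nr q + 1)); first by rewrite divr_gt0.
exists (d / (nr q + 1)) => [|h hd]; first by rewrite divr_gt0.
rewrite rmorphD scalerDl addrA -linearZ.
have hq : nr (h%:K *: q) <= `|h| * (nr q + 1).
  by rewrite nrZ nr_emb ler_wpM2l // lerDl.
rewrite (le_trans (dP _ _)) //; first by rewrite (le_lt_trans hq) // -ltr_pdivlMr.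
rewrite mulrAC ler_pdivrMr // -mulrA ler_wpM2l // ltW //.
Qed.

End Curves.

(** The mean value inequality in the direction v is applied to the increment of f in the direction
    w. This uses the differentiability of ['D_v f] only at a, at the two displacements [h1] and
    [h0]. *)
Lemma second_difference {V : normedModType K} {m} (f : V -> 'rV[K]_m) (a v w : V) :
  (\forall y \near a, differentiable f y) -> differentiable ('D_v f) a ->
  forall e : R, 0 < e -> exists2 d : R, 0 < d & forall t : R, 0 < t < d ->
    nr (f (a + t%:K *: v + t%:K *: w) - f (a + t%:K *: w) - f (a + t%:K *: v)
        + f a - (t ^+ 2)%:K *: 'd ('D_v f) a w) <= e * t ^+ 2.
Proof.
move=> /(nearP_nr S)[r r0 df] dDf e e0.
(* Every displacement in the parallelogram spanned by t v and t w has norm at most t c; the 1 makes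
   c positive. *)
set c := nr v + nr w + 1.
have c0 : 0 < c by rewrite ltr_wpDl ?addr_ge0 ?nr_ge0.
(* Two errors, each at most e / (2 c) times t c, and one more factor t from the mean value
   inequality add up to e t^2. *)
have [|d d0 dP] := diff_nr S dDf (e := e / (2 * c)); first by rewrite divr_gt0 // mulr_gt0.
pose u := Num.min r d.
have u0 : 0 < u by rewrite lt_min r0.
exists (u / c) => [|t /andP[t0 tu]]; first by rewrite divr_gt0.
have tcu : t * c < u by rewrite -ltr_pdivlMr.
have near_a s b : 0 <= s <= 1 -> 0 <= b <= 1 ->
    nr (s%:K *: (t%:K *: v) + b%:K *: (t%:K *: w)) <= t * c.
  move=> /andP[s0 s1] /andP[b0 b1]; apply: le_trans (nrD _ _ _) _.
  rewrite !nrZ !nr_emb !ger0_norm ?(ltW t0) //.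
  rewrite /c !mulrDr mulr1 -[leLHS]addr0 lerD ?(ltW t0) // lerD // ler_piMl //.
    by rewrite mulr_ge0 ?nr_ge0 ?ltW.
  by rewrite mulr_ge0 ?nr_ge0 ?ltW.
pose g s := f (a + t%:K *: w + s%:K *: (t%:K *: v)) - f (a + s%:K *: (t%:K *: v)).
pose g' s := 'd f (a + t%:K *: w + s%:K *: (t%:K *: v)) (t%:K *: v) -
             'd f (a + s%:K *: (t%:K *: v)) (t%:K *: v).
have ball s b : 0 <= s <= 1 -> 0 <= b <= 1 ->
    differentiable f (a + (s%:K *: (t%:K *: v) + b%:K *: (t%:K *: w))).
  move=> s01 b01; apply: df; rewrite addrAC subrr add0r (le_lt_trans (near_a _ _ s01 b01)) //.
  by rewrite (lt_le_trans tcu) // ge_min lexx.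
have ptw s : a + t%:K *: w + s%:K *: (t%:K *: v) =
             a + (s%:K *: (t%:K *: v) + 1%:K *: (t%:K *: w)).
  by rewrite rmorph1 scale1r addrAC addrA.
have ptv s : a + s%:K *: (t%:K *: v) =
             a + (s%:K *: (t%:K *: v) + 0%:K *: (t%:K *: w)).
  by rewrite rmorph0 scale0r addr0.
have i1 : (0 <= (1:R) <= 1)%R by rewrite lexx ler01.
have i0 : (0 <= (0:R) <= 1)%R by rewrite lexx ler01.
have := @mean_value _ g g' ((t ^+ 2)%:K *: 'd ('D_v f) a w) (e * t ^+ 2).
rewrite /g !rmorph1 !rmorph0 !scale1r !scale0r !addr0.
have -> : f (a + t%:K *: w + t%:K *: v) - f (a + t%:K *: v) -
    (f (a + t%:K *: w) - f a) - (t ^+ 2)%:K *: 'd ('D_v f) a w =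
  f (a + t%:K *: v + t%:K *: w) - f (a + t%:K *: w) - f (a + t%:K *: v)
        + f a - (t ^+ 2)%:K *: 'd ('D_v f) a w.
  by rewrite [a + t%:K *: w + _]addrAC; row_ring.
apply; first by rewrite mulr_ge0 ?sqr_ge0 // ltW.
  move=> s s01; apply: real_derivativeB; apply: real_derivative_line.
    by rewrite ptw; apply: ball.
  by rewrite ptv; apply: ball.
move=> s s01; rewrite /g' ptw ptv.
have D1 := ball _ _ s01 i1; have D0 := ball _ _ s01 i0.
have B1 := near_a _ _ s01 i1; have B0 := near_a _ _ s01 i0.
set h1 := _ + 1%:K *: _ in D1 B1 *; set h0 := _ + 0%:K *: _ in D0 B0 *.
have hd (h : V) : nr h <= t * c -> nr h < d.
  by move=> /le_lt_trans -> //; rewrite (lt_le_trans tcu) // ge_min lexx orbT.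
have H1 := dP h1 (hd _ B1); have H0 := dP h0 (hd _ B0).
have h10 : 'd ('D_v f) a h1 - 'd ('D_v f) a h0 = t%:K *: 'd ('D_v f) a w.
  rewrite -linearB -linearZ /h1 /h0 rmorph1 rmorph0 scale1r scale0r addr0.
  by rewrite addrAC subrr add0r.
rewrite ['d f (a + h1) _]linearZ ['d f (a + h0) _]linearZ -(deriveE v D1) -(deriveE v D0).
have -> : t%:K *: 'D_v f (a + h1) - t%:K *: 'D_v f (a + h0) -
    (t ^+ 2)%:K *: 'd ('D_v f) a w =
  t%:K *: (('D_v f (a + h1) - 'D_v f a - 'd ('D_v f) a h1) -
           ('D_v f (a + h0) - 'D_v f a - 'd ('D_v f) a h0)).
  rewrite expr2 rmorphM -scalerA -h10; row_ring.
rewrite nrZ nr_emb gtr0_norm // expr2 mulrCA ler_wpM2l ?(ltW t0) //.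
apply: le_trans (nrB _ _ _) _; apply: le_trans (lerD H1 H0) _.
rewrite -mulrDr (_ : e * t = e / (2 * c) * (t * c + t * c)); last by field; lra.
by rewrite ler_wpM2l ?lerD // divr_ge0 ?mulr_ge0 // ltW.
Qed.

(** The second difference is symmetric in v and w, so t^2 times either mixed derivative approximates
    the same quantity; divide by t^2. *)
Lemma schwarz {V : normedModType K} {m} (f : V -> 'rV[K]_m) (a v w : V) :
  (\forall y \near a, differentiable f y) -> differentiable ('D_v f) a ->
  differentiable ('D_w f) a -> 'd ('D_v f) a w = 'd ('D_w f) a v.
Proof.
move=> df dv dw; apply/eqP; rewrite -subr_eq0; apply/eqP/(nr0_eq0 (S := S)).
apply/eqP; rewrite eq_le nr_ge0 andbT; apply/ler_addgt0Pr => e e0; rewrite add0r.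
have e2 : 0 < e / 2 by rewrite divr_gt0.
have [d1 d10 H1] := @second_difference _ _ f a v w df dv _ e2.
have [d2 d20 H2] := @second_difference _ _ f a w v df dw _ e2.
pose t := Num.min d1 d2 / 2.
have t0 : 0 < t by rewrite divr_gt0 // lt_min d10.
have td : t < Num.min d1 d2 by rewrite ltr_pdivrMr // ltr_pMr ?ltr1n // lt_min d10.
have /H1 {}H1 : 0 < t < d1 by rewrite t0 (lt_le_trans td) // ge_min lexx.
have /H2 {}H2 : 0 < t < d2 by rewrite t0 (lt_le_trans td) // ge_min lexx orbT.
have t2 : 0 < t ^+ 2 by rewrite exprn_gt0.
rewrite -(ler_pM2l t2) -[X in X * nr _](gtr0_norm t2) -(nr_emb S) -nrZ.
apply: le_trans (_ : e / 2 * t ^+ 2 + e / 2 * t ^+ 2 <= _); last first.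
  by rewrite -mulrDl -splitr mulrC.
apply: le_trans (lerD H2 H1); apply: le_trans (nrB _ _ _).
rewrite le_eqVlt; apply/orP; left; apply/eqP; congr (rnorm _ _).
by rewrite [a + t%:K *: w + _]addrAC; row_ring.
Qed.

End MeanValue.

(** * Real and complex scalars: compact unit balls, uncountable intervals *)

Lemma real_unit_ball_compact (R : realType) : compact [set x : R | `|x| <= 1].
Proof.
rewrite (_ : mkset _ = `[(-1), 1]%classic); first exact: segment_compact.
by apply/seteqP; split=> x /=; rewrite in_itv /= ler_norml.
Qed.

Lemma real_complex_continuous (R : realType) :
  continuous (fun x : R => (x%:C)%C : (R[i] : numFieldType)).
Proof.
move=> x; apply/cvgrPdist_lt => e e0; have := e0; rewrite ltcE /= => /andP[/eqP ei re].
have eE : e = ((complex.Re e)%:C)%C by apply/eqP; rewrite eq_complex /= ei !eqxx.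
near=> y; rewrite -rmorphB normc_def /= expr0n addr0 sqrtr_sqr eE ltcR.
near: y; apply/nbhs_normP; exists (complex.Re e).
Unshelve. all: by end_near. Qed.

(** The complex disk is a continuous image of the real disk [D], which is closed in a compact
    square. *)
Lemma complex_unit_ball_compact (R : realType) :
  compact [set x : (R[i] : numFieldType) | `|x| <= 1].
Proof.
pose f (p : R * R) : (R[i] : numFieldType) := (p.1%:C + 'i * p.2%:C)%C.
have fc : continuous f.
  move=> p; apply: cvgD.
    by apply: continuous_comp; [exact: cvg_fst|exact: real_complex_continuous].
  apply: cvgM; first exact: cvg_cst.
  by apply: continuous_comp; [exact: cvg_snd|exact: real_complex_continuous].
pose D := [set p : R * R | p.1 ^+ 2 + p.2 ^+ 2 <= 1].
have Dc : compact D.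
  apply: (@subclosed_compact _ _ ([set x : R | `|x| <= 1] `*` [set x : R | `|x| <= 1])).
  - have -> : D = (fun p : R * R => p.1 ^+ 2 + p.2 ^+ 2) @^-1` [set y | y <= 1] by [].
    apply: preimage_closed; last exact: closed_le.
    move=> p _; have c1 : (fun q : R * R => q.1 : R^o) @ p --> (p.1 : R^o) by exact: cvg_fst.
    have c2 : (fun q : R * R => q.2 : R^o) @ p --> (p.2 : R^o) by exact: cvg_snd.
    have := cvgD (cvgM c1 c1) (cvgM c2 c2). exact.
  - by apply: compact_setX; apply: real_unit_ball_compact.
  - move=> p pD; have p0 (a b : R) : a ^+ 2 + b ^+ 2 <= 1 -> `|a| <= 1.
      move=> ab; rewrite -(@expr_le1 _ 2) // real_normK ?num_real //.
      by apply: le_trans ab; rewrite lerDl sqr_ge0.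
    by split; [apply: p0 pD|apply: (p0 _ p.1); rewrite addrC].
rewrite (_ : mkset _ = f @` D).
  by apply: continuous_compact => //; exact: continuous_subspaceT.
apply/seteqP; split=> x /=.
  rewrite normc_def lecE /= eqxx /= => x1; exists (complex.Re x, complex.Im x).
    have p0 : 0 <= complex.Re x ^+ 2 + complex.Im x ^+ 2 by rewrite addr_ge0 ?sqr_ge0.
    by rewrite /D /= -(sqr_sqrtr p0) expr_le1 ?sqrtr_ge0.
  by rewrite /f /= -complexE.
case=> -[a b] /= ab <-; rewrite /f /= normc_def lecE /= eqxx /=.
rewrite -[leRHS]sqrtr1 ler_wsqrtr //; apply: le_trans ab; rewrite le_eqVlt; apply/orP; left.
by apply/eqP; congr (_ ^+ 2 + _ ^+ 2); rewrite /=; ring.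
Qed.

Definition scalars_real_norm (R : realType) (k : ground) : real_norm R (scalars R k) :=
  match k with
  | RealNumbers => @RealNorm R R idfun (fun _ _ => erefl)
      (fun x _ => ex_intro _ x erefl) (@real_unit_ball_compact R)
  | ComplexNumbers => @RealNorm R R[i]%C (real_complex R) (@lecR R)
      (fun x x0 => ex_intro _ (complex.Re x) (esym (RRe_real (ger0_real x0))))
      (@complex_unit_ball_compact R)
  end.

Lemma uncountable_interval (R : realType) (d : R) : 0 < d ->
  ~ countable [set t : R | 0 < t < d].
Proof.
move=> d0 /countable_lebesgue_measure0.
rewrite (_ : mkset _ = `]0, d[%classic); last first.
  by apply/seteqP; split=> x /=; rewrite in_itv.
rewrite lebesgue_measure_itv /= lte_fin d0 oppr0 adde0 => -[] /eqP.
by rewrite gt_eqF.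
Qed.

(** * Differentials of maps between manifolds *)

Section NearEq.
Context {R : realType} {K : numFieldType} (S : real_norm R K).

(** Coordinate expressions coincide only near the centre of a chart, so differentials are compared
    on germs. *)
Lemma near_eq_diff {V W : normedModType K} (f g : V -> W) x :
  (\forall y \near x, f y = g y) -> differentiable f x ->
  differentiable g x /\ 'd g x = 'd f x :> (V -> W).
Proof.
move=> fg df; have fgx := nbhs_singleton fg.
apply: (diff_nrP (S := S)) => [|e e0]; first exact: diff_continuous.
have [d d0 dP] := diff_nr S df e0; move/(nearP_nr S): fg => [r r0 fg].
exists (Num.min d r) => [|h]; first by rewrite lt_min d0.
rewrite lt_min => /andP[/dP + hr]; rewrite fgx fg //.
by rewrite addrAC subrr add0r.
Qed.

Lemma smooth_differentiable {V W : normedModType K} (U : set V) (f : V -> W) x :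
  smooth U f -> U x -> differentiable f x.
Proof. by move=> /(_ 1%N)[+ _] Ux; apply. Qed.

Lemma smooth_derive_differentiable {V W : normedModType K} (U : set V) (f : V -> W) x v :
  smooth U f -> U x -> differentiable ('D_v f) x.
Proof. by move=> /(_ 2%N)[_ /(_ v)[+ _]] Ux; apply. Qed.

End NearEq.

Section Charts.
Context {R : realType} {K : numFieldType} (S : real_norm R K).

Lemma chart_at_dom {n} {M : manifoldType K n} (x : M) : chart_dom (chart_at x) x.
Proof. exact: (s2valP' (cid2 (atlas_cover x))). Qed.

Lemma chart_at_atlas {n} {M : manifoldType K n} (x : M) : atlas (chart_at x).
Proof. exact: (s2valP (cid2 (atlas_cover x))). Qed.

Lemma chart_at_cod {n} {M : manifoldType K n} (x : M) :
  chart_cod (chart_at x) (chart_at x x).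
Proof. by exists x => //; apply: chart_at_dom. Qed.

Lemma chart_at_K {n} {M : manifoldType K n} (x : M) :
  chart_inv (chart_at x) (chart_at x x) = x.
Proof. by apply: chart_mapK; apply: chart_at_dom. Qed.

Lemma chart_inv_dom {n} {T : topologicalType} (c : chart K n T) v :
  chart_cod c v -> chart_dom c (chart_inv c v).
Proof. by case=> x xc <-; rewrite chart_mapK. Qed.

Lemma chart_invK {n} {T : topologicalType} (c : chart K n T) v :
  chart_cod c v -> c (chart_inv c v) = v.
Proof. by case=> x xc <-; rewrite chart_mapK. Qed.

Lemma near_chart_cod {n} {T : topologicalType} (c : chart K n T) x :
  chart_dom c x -> \forall v \near c x, chart_cod c v.
Proof.
move=> xc; apply: open_nbhs_nbhs; split; first exact: chart_cod_open.
by exists x.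
Qed.

Lemma near_chart_inv {n} {T : topologicalType} (c : chart K n T) x (P : T -> Prop) :
  chart_dom c x -> (\forall y \near x, P y) -> \forall v \near c x, P (chart_inv c v).
Proof.
move=> xc xP; have := chart_inv_cont (ex_intro2 _ _ x xc (erefl (c x))); move=> cc.
by apply: cc; rewrite chart_mapK.
Qed.

(** Continuity is a separate clause: it keeps f y in the domain of the chart at f x for y near x,
    outside which chart values are arbitrary. Coordinate expressions can then be composed. *)
Definition mdifferentiable {m n} {M : manifoldType K m} {N : manifoldType K n}
    (f : M -> N) (x : M) : Prop :=
  {for x, continuous f} /\
  differentiable (chart_at (f x) \o f \o chart_inv (chart_at x)) (chart_at x x).

Lemma smooth_mdifferentiable {m n} {M : manifoldType K m} {N : manifoldType K n}
  (f : M -> N) (x : M) : smooth_map f -> mdifferentiable f x.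
Proof.
move=> [cf sf]; split; first exact: cf.
apply: smooth_differentiable (sf _ _ (chart_at_atlas _) (chart_at_atlas _)) _.
split; first exact: chart_at_cod.
by rewrite /= chart_at_K; apply: chart_at_dom.
Qed.

Lemma smooth2_mdifferentiable_r {m1 m2 n} {M1 : manifoldType K m1}
    {M2 : manifoldType K m2} {N : manifoldType K n} (f : M1 -> M2 -> N) a x :
  smooth_map2 f -> mdifferentiable (f a) x.
Proof.
move=> [cf sf]; split.
  apply: (continuous_comp (f := fun y => (a, y)) (g := fun p => f p.1 p.2)) (cf _).
  by apply: cvg_pair; [exact: cvg_cst|exact: cvg_id].
set F := (fun v : 'rV[K]_m1 * 'rV[K]_m2 =>
  chart_at (f a x) (f (chart_inv (chart_at a) v.1) (chart_inv (chart_at x) v.2))).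
have -> : chart_at (f a x) \o f a \o chart_inv (chart_at x) =
    F \o (fun v => (chart_at a a, v)).
  by apply/funext => v; rewrite /F /= chart_at_K.
apply: differentiable_comp.
  by apply: differentiable_pair; [exact: differentiable_cst|exact: ex_diff].
apply: smooth_differentiable (sf _ _ _ (chart_at_atlas _) (chart_at_atlas _) (chart_at_atlas _)) _.
split=> /=; [exact: chart_at_cod|exact: chart_at_cod|].
by rewrite !chart_at_K; apply: chart_at_dom.
Qed.

Lemma smooth2_mdifferentiable_l {m1 m2 n} {M1 : manifoldType K m1}
    {M2 : manifoldType K m2} {N : manifoldType K n} (f : M1 -> M2 -> N) a x :
  smooth_map2 f -> mdifferentiable (f^~ a) x.
Proof.
move=> [cf sf]; split.
  apply: (continuous_comp (f := fun y => (y, a)) (g := fun p => f p.1 p.2)) (cf _).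
  by apply: cvg_pair; [exact: cvg_id|exact: cvg_cst].
set F := (fun v : 'rV[K]_m1 * 'rV[K]_m2 =>
  chart_at (f x a) (f (chart_inv (chart_at x) v.1) (chart_inv (chart_at a) v.2))).
have -> : chart_at (f x a) \o f^~ a \o chart_inv (chart_at x) =
    F \o (fun v => (v, chart_at a a)).
  by apply/funext => v; rewrite /F /= chart_at_K.
apply: differentiable_comp.
  by apply: differentiable_pair; [exact: ex_diff|exact: differentiable_cst].
apply: smooth_differentiable (sf _ _ _ (chart_at_atlas _) (chart_at_atlas _) (chart_at_atlas _)) _.
split=> /=; [exact: chart_at_cod|exact: chart_at_cod|].
by rewrite !chart_at_K; apply: chart_at_dom.
Qed.

Section Comp.
Context {m n p : nat} {M : manifoldType K m} {N : manifoldType K n} {P : manifoldType K p}.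
Variables (f : M -> N) (g : N -> P) (x : M).
Hypotheses (df : mdifferentiable f x) (dg : mdifferentiable g (f x)).

Let chart_comp : \forall v \near chart_at x x,
  ((chart_at (g (f x)) \o g \o chart_inv (chart_at (f x))) \o
   (chart_at (f x) \o f \o chart_inv (chart_at x))) v =
  (chart_at (g (f x)) \o (g \o f) \o chart_inv (chart_at x)) v.
Proof.
have : \forall y \near x, chart_dom (chart_at (f x)) (f y).
  apply: df.1; apply: open_nbhs_nbhs; split; first exact: chart_dom_open.
  exact: chart_at_dom.
move=> /(near_chart_inv (chart_at_dom x)); apply: filterS => v vd.
by rewrite /= chart_mapK.
Qed.

Let center : (chart_at (f x) \o f \o chart_inv (chart_at x)) (chart_at x x) =
  chart_at (f x) (f x).
Proof. by rewrite /= chart_at_K. Qed.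

Let dg' : differentiable (chart_at (g (f x)) \o g \o chart_inv (chart_at (f x)))
  ((chart_at (f x) \o f \o chart_inv (chart_at x)) (chart_at x x)).
Proof. by rewrite center; apply: dg.2. Qed.

Lemma mdifferentiable_comp : mdifferentiable (g \o f) x.
Proof.
split; first by apply: continuous_comp; [exact: df.1|exact: dg.1].
by have [] := near_eq_diff S chart_comp (differentiable_comp df.2 dg').
Qed.

Lemma tangent_comp v :
  tangent_map (g \o f) x v = tangent_map g (f x) (tangent_map f x v).
Proof.
have [_ E] := near_eq_diff S chart_comp (differentiable_comp df.2 dg').
have E2 := diff_comp df.2 dg'.
rewrite /tangent_map E E2 center.
by [].
Qed.

End Comp.

Lemma tangent_id {n} {M : manifoldType K n} (x : M) v : tangent_map id x v = v.
Proof.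
have E : \forall v \near chart_at x x,
    v = (chart_at x \o id \o chart_inv (chart_at x)) v.
  apply: filterS (near_chart_cod (chart_at_dom x)) => u uc.
  by rewrite /= chart_invK.
have [_ /= ->] := near_eq_diff S E (@ex_diff _ _ _ _ _ _ _ (is_diff_id _)).
by rewrite diff_val.
Qed.

End Charts.

(** * The adjoint representation as a group action *)

Section LieGroup.
Context {R : realType} {K : numFieldType} (S : real_norm R K).
Context {n : nat} {G : lieGroupType K n}.
Implicit Types (g h x : G).

Definition conj_by g : G -> G := fun x => (g * x * g^-1)%g.

Lemma conj_by1 g : conj_by g 1%g = 1%g.
Proof. by rewrite /conj_by mulg1 mulgV. Qed.

Lemma mdifferentiable_conj g x : mdifferentiable (conj_by g) x.
Proof.
apply: (mdifferentiable_comp S (f := fun y => (g * y)%g) (g := fun y => (y * g^-1)%g)).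
  exact: (smooth2_mdifferentiable_r _ _ (@smooth_mulg _ _ G)).
exact: (smooth2_mdifferentiable_l _ _ (@smooth_mulg _ _ G)).
Qed.

Lemma AdE g xi : Ad g xi = tangent_map (conj_by g) 1%g xi.
Proof. by rewrite /Ad mul_rV_lin1. Qed.

Lemma AdM g h xi : Ad (g * h)%g xi = Ad g (Ad h xi).
Proof.
have E := tangent_comp S (mdifferentiable_conj h 1%g) (mdifferentiable_conj g (conj_by h 1%g)) xi.
rewrite (AdE g) (AdE h) (AdE (g * h)%g).
rewrite conj_by1 in E.
suff -> : conj_by (g * h)%g = conj_by g \o conj_by h by exact: E.
apply/funext => x; rewrite /conj_by /=.
by rewrite invgM !mulgA.
Qed.

Lemma Ad1 xi : Ad (1%g : G) xi = xi.
Proof.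
rewrite AdE (_ : conj_by 1%g = id) ?(tangent_id S) //.
by apply/funext => x; rewrite /conj_by mul1g invg1 mulg1.
Qed.

Lemma Ad_mxM g h : Ad_mx (g * h)%g = Ad_mx h *m Ad_mx g.
Proof. by apply/row_matrixP => i; rewrite !rowE -/(Ad _ _) AdM /Ad mulmxA. Qed.

Lemma Ad_mx1 : Ad_mx (1%g : G) = 1%:M.
Proof. by apply/row_matrixP => i; rewrite !rowE -/(Ad _ _) Ad1 mulmx1. Qed.

End LieGroup.

Section PartialDiff.
Context {K : numFieldType} {V1 V2 W : normedModType K}.
Variables (F : V1 * V2 -> W) (a : V1) (b : V2).
Hypothesis dF : differentiable F (a, b).

Lemma differentiable_partial1 : differentiable (fun x => F (x, b)) a.
Proof.
apply: (differentiable_comp (f := fun x => (x, b)) (g := F)) => //.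
Qed.

Lemma diff_partial1 w : 'd (fun x => F (x, b)) a w = 'd F (a, b) (w, 0).
Proof.
have dp : differentiable (fun x : V1 => (x, b)) a.
  by apply: differentiable_pair; [exact: ex_diff|exact: differentiable_cst].
have -> := diff_comp dp dF; congr ('d F _ _) => /=.
rewrite diff_pair; [|exact: ex_diff|exact: differentiable_cst].
by rewrite diff_val diff_cst.
Qed.

Lemma differentiable_partial2 : differentiable (fun y => F (a, y)) b.
Proof.
apply: (differentiable_comp (f := fun y => (a, y)) (g := F)) => //.
Qed.

Lemma diff_partial2 w : 'd (fun y => F (a, y)) b w = 'd F (a, b) (0, w).
Proof.
have dp : differentiable (fun y : V2 => (a, y)) b.
  by apply: differentiable_pair; [exact: differentiable_cst|exact: ex_diff].
have -> := diff_comp dp dF; congr ('d F _ _) => /=.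
rewrite diff_pair; [|exact: differentiable_cst|exact: ex_diff].
by rewrite !diff_val.
Qed.

End PartialDiff.

(** * Multiplication, adjoint representation and bracket in a chart *)

Section LocalMultiplication.
Context {R : realType} {K : numFieldType} (S : real_norm R K).
Context {n : nat} {G : lieGroupType K n}.
Local Notation nr := (rnorm S).
Local Notation c := (chart_at (1%g : G)).
Local Notation e := (chart_at (1%g : G) 1%g).
Local Notation V := 'rV[K]_n.

Definition chart_mul (p : V * V) : V := c (chart_inv c p.1 * chart_inv c p.2)%g.

Definition chart_mul_dom : set (V * V) := [set p : V * V | [/\ chart_cod c p.1,
  chart_cod c p.2 & chart_dom c (chart_inv c p.1 * chart_inv c p.2)%g]].

Lemma chart_mul_smooth : smooth chart_mul_dom chart_mul.
Proof.
have [_ sm] := @smooth_mulg _ _ G.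
exact: (sm _ _ _ (chart_at_atlas _) (chart_at_atlas _) (chart_at_atlas _)).
Qed.

Lemma near_chart_mul_dom : \forall p \near (e, e), chart_mul_dom p.
Proof.
have [cm _] := @smooth_mulg _ _ G.
have cd : chart_dom c (1%g : G) := chart_at_dom _.
have : \forall q \near (1%g : G, 1%g : G), chart_dom c (q.1 * q.2)%g.
  apply: cm; apply: open_nbhs_nbhs; split; first exact: chart_dom_open.
  by rewrite /= mulg1.
case=> -[A B] /= [A1 B1] AB.
exists ([set v | chart_cod c v /\ A (chart_inv c v)],
        [set v | chart_cod c v /\ B (chart_inv c v)]) => /=.
  by split; apply: filterI; by [exact: near_chart_cod|exact: near_chart_inv].
by move=> -[u v] /= [[uc uA] [vc vB]]; split=> //; apply: (AB (_, _)).
Qed.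

Lemma chart_mul_e_r u : chart_cod c u -> chart_mul (u, e) = u.
Proof. by move=> uc; rewrite /chart_mul /= chart_at_K mulg1 chart_invK. Qed.

Lemma chart_mul_e_l u : chart_cod c u -> chart_mul (e, u) = u.
Proof. by move=> uc; rewrite /chart_mul /= chart_at_K mul1g chart_invK. Qed.

Lemma chart_mul_dom_e_r u : chart_cod c u -> chart_mul_dom (u, e).
Proof.
move=> uc; split=> //=; first exact: chart_at_cod.
by rewrite chart_at_K mulg1; apply: chart_inv_dom.
Qed.

Lemma chart_mul_dom_e_l u : chart_cod c u -> chart_mul_dom (e, u).
Proof.
move=> uc; split=> //=; first exact: chart_at_cod.
by rewrite chart_at_K mul1g; apply: chart_inv_dom.
Qed.

Lemma chart_inv_mul p : chart_mul_dom p ->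
  chart_inv c (chart_mul p) = (chart_inv c p.1 * chart_inv c p.2)%g.
Proof. by move=> [_ _ pd]; rewrite /chart_mul chart_mapK. Qed.

Lemma differentiable_chart_mul p : chart_mul_dom p -> differentiable chart_mul p.
Proof. exact: smooth_differentiable chart_mul_smooth. Qed.

Lemma differentiable_derive_chart_mul v p : chart_mul_dom p ->
  differentiable ('D_v chart_mul) p.
Proof. exact: smooth_derive_differentiable chart_mul_smooth. Qed.

Let ee : chart_mul_dom (e, e).
Proof. by apply: chart_mul_dom_e_r; apply: chart_at_cod. Qed.

Lemma diff_chart_mul_e1 w : 'd chart_mul (e, e) (w, 0) = w.
Proof.
rewrite -diff_partial1; last exact: differentiable_chart_mul.
have E : \forall u \near e, u = chart_mul (u, e).
  by apply: filterS (near_chart_cod (chart_at_dom _)) => u uc; rewrite chart_mul_e_r.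
have [_ ->] := near_eq_diff S E (@ex_diff _ _ _ _ _ _ _ (is_diff_id _)).
by rewrite diff_val.
Qed.

Lemma diff_chart_mul_e2 w : 'd chart_mul (e, e) (0, w) = w.
Proof.
rewrite -diff_partial2; last exact: differentiable_chart_mul.
have E : \forall u \near e, u = chart_mul (e, u).
  by apply: filterS (near_chart_cod (chart_at_dom _)) => u uc; rewrite chart_mul_e_l.
have [_ ->] := near_eq_diff S E (@ex_diff _ _ _ _ _ _ _ (is_diff_id _)).
by rewrite diff_val.
Qed.

(** Strict differentiability in the second factor, uniformly in the first: the partial derivative is
    the identity at (e, e), stays close to it nearby, and is integrated along the segment from v' to
    v. It controls both the growth of powers and quotients of nearby points. *)
Lemma chart_mul_strict (eps : R) : 0 < eps -> exists2 d : R, 0 < d &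
  forall u v v', nr (u - e) < d -> nr (v - e) < d -> nr (v' - e) < d ->
    chart_mul_dom (u, v) /\
    nr (chart_mul (u, v) - chart_mul (u, v') - (v - v')) <= eps * nr (v - v').
Proof.
move=> eps0.
(* [rV_basis_bound] costs a factor n; the successor avoids dividing by 0. *)
pose eps' := eps / n.+1%:R; have eps'0 : 0 < eps' by rewrite divr_gt0.
(* Smoothness gives continuity of the derivative in each fixed direction, so closeness to the
   identity is first obtained on the finitely many basis directions. *)
have /(nearP_nr S)[d d0 dP] : \forall p \near (e, e), chart_mul_dom p /\
    forall i, nr ('D_(0, delta_mx 0 i) chart_mul p - delta_mx 0 i) <= eps'.
  apply: filterI; first exact: near_chart_mul_dom.
  have FF := nbhs_filter (e, e).
  apply: (@filter_forall _ 'I_n (fun i p =>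
    nr ('D_(0, delta_mx 0 i) chart_mul p - delta_mx 0 i) <= eps') _ FF) => i.
  have D0 : 'D_(0, delta_mx 0 i) chart_mul (e, e) = delta_mx 0 i.
    rewrite (deriveE _ (differentiable_chart_mul ee)); exact: diff_chart_mul_e2.
  have /differentiable_continuous /(continuous_atP_nr S)/(_ _ eps'0)[d d0 dP] :=
    differentiable_derive_chart_mul (0, delta_mx 0 i) ee.
  apply: (proj2 (nearP_nr S (e, e) _)); exists d => // p /dP /ltW.
  by rewrite -[X in _ -> nr (_ - X) <= _]D0.
have bound u v : nr (u - e) < d -> nr (v - e) < d -> chart_mul_dom (u, v) /\
    forall w, nr ('d chart_mul (u, v) (0, w) - w) <= eps * nr w.
  move=> ud vd; have [|dom bd] := dP (u, v); first by rewrite nr_pair gt_max ud.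
  split=> // w.
  have lf : linear (fun w : V => 'd chart_mul (u, v) (0, w) - w).
    move=> a x y; rewrite (_ : (0, a *: x + y) = a *: (0, x) + (0, y)); last first.
      by rewrite -[RHS]/(a *: 0 + 0, a *: x + y) scaler0 addr0.
    by rewrite linearP; row_ring.
  apply: le_trans (rV_basis_bound lf (c := eps') _ w) _ => [i|].
    by rewrite -deriveE; [exact: bd|exact: differentiable_chart_mul].
  rewrite ler_wpM2r ?nr_ge0 // /eps' mulrCA ler_piMr ?(ltW eps0) //.
  by rewrite ler_pdivrMr // mul1r ler_nat.
exists d => // u v v' ud vd v'd; split; first by have [] := bound _ _ ud vd.
have seg s : 0 <= s <= 1 -> nr (v' + (emb S s) *: (v - v') - e) < d.
  move=> /andP[s0 s1].
  have -> : v' + (emb S s) *: (v - v') - e =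
      (emb S s) *: (v - e) + (emb S (1 - s)) *: (v' - e) by row_ring.
  apply: le_lt_trans (nrD _ _ _) _; rewrite !nrZ !nr_emb !ger0_norm ?subr_ge0 //.
  apply: le_lt_trans (_ : Num.max (nr (v - e)) (nr (v' - e)) < d); last first.
    by rewrite gt_max vd.
  set M := Num.max _ _.
  have vM : nr (v - e) <= M by rewrite le_max lexx.
  have v'M : nr (v' - e) <= M by rewrite le_max lexx orbT.
  by rewrite -[leRHS]mul1r -[X in X * M](subrKC s 1) [leRHS]mulrDl lerD // ler_wpM2l ?subr_ge0.
pose g s := chart_mul ((u, v') + (emb S s) *: (0, v - v')).
pose g' s := 'd chart_mul ((u, v') + (emb S s) *: (0, v - v')) (0, v - v').
have lineE s : (u, v') + (emb S s) *: ((0 : V), v - v') = (u, v' + (emb S s) *: (v - v')).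
  by rewrite -[LHS]/(u + emb S s *: 0, v' + emb S s *: (v - v')) scaler0 addr0.
have := @mean_value _ _ S _ g g' (v - v') (eps * nr (v - v')).
have -> : g 1 = chart_mul (u, v).
  by rewrite /g lineE rmorph1 scale1r addrC subrK.
have -> : g 0 = chart_mul (u, v').
  by rewrite /g lineE rmorph0 scale0r addr0.
apply=> [|t /seg td|t /seg td]; first by rewrite mulr_ge0 ?nr_ge0 // ltW.
  apply: real_derivative_line; rewrite lineE.
  by apply: differentiable_chart_mul; have [] := bound _ _ ud td.
by rewrite /g' lineE; have [_] := bound _ _ ud td; apply.
Qed.

End LocalMultiplication.

Section Germs.
Context {R : realType} {K : numFieldType} (S : real_norm R K).
Context {n : nat}.
Local Notation nr := (rnorm S).
Local Notation V := 'rV[K]_n.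

(** Both sides of [mul (u, v) = mul (C v, u)] are differentiated at v = e in the direction w; since
    [C e = e], the right side gives the first partial at (e, u), applied to [a]. *)
Lemma diff_conj_germ (mul : V * V -> V) (C : V -> V) (e u w a : V) :
  differentiable mul (u, e) -> differentiable mul (e, u) ->
  C e = e -> differentiable C e -> 'd C e w = a ->
  (\forall v \near e, mul (u, v) = mul (C v, u)) ->
  'd mul (e, u) (a, 0) = 'd mul (u, e) (0, w).
Proof.
move=> d1 d2 Ce dC dCw E.
have d2' : differentiable (fun p => mul (p, u)) (C e).
  by rewrite Ce; apply: differentiable_partial1.
have [_ D] := near_eq_diff S E (differentiable_partial2 d1).
have D2 := diff_comp dC d2'.
have D3 : 'd (fun p => mul (p, u)) (C e) a = 'd mul (e, u) (a, 0).
  by rewrite Ce; exact: (diff_partial1 d2 a).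
have D4 := etrans (congr1 (fun f => f w) D) (diff_partial2 d1 w).
have D5 := etrans (congr1 (fun f => f w) D2) (congr1 ('d (fun p => mul (p, u)) (C e)) dCw).
exact: (etrans (esym D3) (etrans (esym D5) D4)).
Qed.

(* [al u] stands for Ad at the point of coordinates [u].  By [alP], Ad is
   D1^-1 D2 with D1, D2 the partial derivatives of the multiplication; both are
   the identity at [e], so Ad has there the derivative of D2 - D1. *)
Section AdjointGerm.
Variables (mul : V * V -> V) (e : V) (al : V -> 'M[K]_n).
Hypothesis dmul_l : \forall u \near e, differentiable mul (e, u).
Hypothesis dmul_r : \forall u \near e, differentiable mul (u, e).
Hypothesis ddmul : forall v, differentiable ('D_v mul) (e, e).
Hypothesis mul_e1 : forall w, 'd mul (e, e) (w, 0) = w.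
Hypothesis mul_e2 : forall w, 'd mul (e, e) (0, w) = w.
Hypothesis al_e : al e = 1%:M.
Hypothesis alP : \forall u \near e, forall w,
  'd mul (e, u) (w *m al u, 0) = 'd mul (u, e) (0, w).

Let D1 w u := 'D_(w, 0) mul (e, u).
Let D2 w u := 'D_(0, w) mul (u, e).

Let dD1 w : differentiable (D1 w) e.
Proof. exact: (differentiable_partial2 (F := 'D_(w, 0) mul)). Qed.

Let dD2 w : differentiable (D2 w) e.
Proof. exact: (differentiable_partial1 (F := 'D_(0, w) mul)). Qed.

Let D1e w : D1 w e = w.
Proof. by rewrite /D1 deriveE ?mul_e1 //; exact: (nbhs_singleton dmul_l). Qed.

Let D2e w : D2 w e = w.
Proof. by rewrite /D2 deriveE ?mul_e2 //; exact: (nbhs_singleton dmul_r). Qed.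

Let D1_lipschitz : exists2 C : R, 0 < C & \forall u \near e,
  forall a, nr ('d mul (e, u) (a, 0) - a) <= C * nr (u - e) * nr a.
Proof.
have [C C0 CP] := fin_all_exists2 (fun i : 'I_n => diff_lipschitz S (dD1 (delta_mx 0 i))).
pose C' := n%:R * \sum_i C i + 1.
exists C'; first by rewrite ltr_wpDl // mulr_ge0 ?sumr_ge0 // => i _; rewrite ltW.
have FF := nbhs_filter e.
have CP' := @filter_forall _ 'I_n _ _ FF CP.
apply: filterS2 CP' dmul_l => u /= Cu du a.
have lf : linear (fun a : V => 'd mul (e, u) (a, 0) - a).
  move=> k x y; rewrite (_ : (k *: x + y, 0) = k *: (x, 0) + (y, 0)); last first.
    by rewrite -[RHS]/(k *: x + y, k *: 0 + 0) scaler0 addr0.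
  by rewrite linearP; row_ring.
apply: le_trans (rV_basis_bound lf (c := (\sum_i C i) * nr (u - e)) _ a) _ => [i|].
  have E : D1 (delta_mx 0 i) u = 'd mul (e, u) (delta_mx 0 i, 0) := deriveE _ du.
  have := Cu i; rewrite D1e E => /le_trans; apply.
  rewrite ler_wpM2r ?nr_ge0 // (bigD1 i) //= lerDl sumr_ge0 // => j _; exact: ltW.
rewrite ler_wpM2r ?nr_ge0 // mulrA ler_wpM2r ?nr_ge0 //.
by rewrite /C' lerDl.
Qed.

Let F w u := D2 w u - D1 w u.

Let dF w : differentiable (F w) e.
Proof. exact: differentiableB. Qed.

Let Fe w : F w e = 0.
Proof. by rewrite /F D1e D2e subrr. Qed.

(** With z = w al(u) - w and L the first partial at (e, u), [alP] says that L (w + z) is [D2 w u].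
    Hence z is [F w u] up to L z - z, which [D1_lipschitz] bounds by C |u - e| |z|. *)
Let alE w : \forall u \near e,
  w *m al u - w = F w u - ('d mul (e, u) (w *m al u - w, 0) - (w *m al u - w)).
Proof.
apply: filterS3 alP dmul_l dmul_r => u /= Hal dl dr.
have E2 : D2 w u = 'd mul (e, u) (w *m al u, 0) := etrans (deriveE _ dr) (esym (Hal w)).
have E1 : D1 w u = 'd mul (e, u) (w, 0) := deriveE _ dl.
rewrite /F E1 E2; move: ('d mul (e, u)) => L.
have -> : L (w *m al u - w, 0) = L (w *m al u, 0) - L (w, 0).
  by rewrite -linearB; congr (L _); rewrite -[RHS]/(w *m al u - w, 0 - 0) subr0.
row_ring.
Qed.

(** [alE] is an implicit equation for z. For u near e its error term is absorbed, which gives z =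
    O(|u - e|); fed back, this makes the error quadratic, so z and [F w] have the same derivative.
    The first partial is never inverted. *)
Lemma diff_adjoint_germ w :
  differentiable (fun u => w *m al u) e /\
  forall xi, 'd (fun u => w *m al u) e xi =
    'd ('D_(0, w) mul) (e, e) (xi, 0) - 'd ('D_(w, 0) mul) (e, e) (0, xi).
Proof.
have [C C0 CP] := D1_lipschitz; have [C2 C20 C2P] := diff_lipschitz S (dF w).
have [] := @diff_nrP _ _ S _ _ (fun u => w *m al u) e 'd (F w) e.
- exact: diff_continuous.
- move=> eps eps0; have eps2 : 0 < eps / 2 by rewrite divr_gt0.
  have [d d0 dP] := diff_nr S (dF w) eps2.
  have [d' d'0 dP'] := proj1 (nearP_nr S e _) (filterI (filterI CP C2P) (alE w)).
  (* The bound (2 C)^-1 gives |z| <= 2 |F|; the bound eps / (4 C C2) then makes C |h| (2 C2 |h|) at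
     most (eps / 2) |h|. *)
  pose dd := Num.min (Num.min d d') (Num.min (2 * C)^-1 (eps / (4 * C * C2))).
  have dd0 : 0 < dd.
    by rewrite !lt_min d0 d'0 /= invr_gt0 divr_gt0 ?mulr_gt0.
  exists dd => // h; rewrite !lt_min -!andbA => /and4P[h1 h2 h3 h4].
  have eh : e + h - e = h by rewrite addrAC subrr add0r.
  have [|[H1 H2] H3] := dP' (e + h); first by rewrite eh.
  rewrite eh Fe subr0 in H2; rewrite al_e mulmx1.
  have {}H1 := H1 (w *m al (e + h) - w); rewrite eh in H1.
  set z := w *m al (e + h) - w in H1 H3 *.
  set y := 'd mul (e, e + h) (z, 0) - z in H1 H3.
  have {}H4 := dP h h1; rewrite Fe subr0 in H4.
  have zF : nr z <= 2 * nr (F w (e + h)).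
    have : nr z <= nr (F w (e + h)) + nr y by rewrite [in leLHS]H3 nrB.
    have : C * nr h * nr z <= 2^-1 * nr z.
      rewrite ler_wpM2r ?nr_ge0 // -ler_pdivlMl // -invfM ltW // mulrC.
      by move: h3; rewrite mulrC.
    have := nr_ge0 S z; lra.
  have -> : z - 'd (F w) e h = F w (e + h) - 'd (F w) e h - y by rewrite [in LHS]H3; row_ring.
  apply: le_trans (nrB _ _ _) _; rewrite [eps]splitr mulrDl lerD //.
  apply: le_trans H1 _.
  have hC2 : nr h * (4 * C * C2) < eps by rewrite -ltr_pdivlMr // ?mulr_gt0.
  have : nr z <= 2 * (C2 * nr h) by apply: le_trans zF _; rewrite ler_pM2l.
  have h0 := nr_ge0 S h; move=> zb.
  apply: le_trans (_ : C * nr h * (2 * (C2 * nr h)) <= _).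
    by rewrite ler_wpM2l // mulr_ge0 // ltW.
  nra.
move=> dal E; split; first exact: dal.
move=> xi; have B := congr1 (fun f => f xi) (diffB (dD2 w) (dD1 w)).
have P1 : 'd (D2 w) e xi = 'd ('D_(0, w) mul) (e, e) (xi, 0).
  exact: (diff_partial1 (ddmul (0, w)) xi).
have P2 : 'd (D1 w) e xi = 'd ('D_(w, 0) mul) (e, e) (0, xi).
  exact: (diff_partial2 (ddmul (w, 0)) xi).
exact: (etrans (congr1 (fun f => f xi) E) (etrans B (congr2 (fun x y => x - y) P1 P2))).
Qed.

End AdjointGerm.
End Germs.

Section AdjointChart.
Context {R : realType} {K : numFieldType} (S : real_norm R K).
Context {n : nat} {G : lieGroupType K n}.
Local Notation c := (chart_at (1%g : G)).
Local Notation e := (chart_at (1%g : G) 1%g).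
Local Notation mul := (@chart_mul K n G).

Let dom_e : chart_dom c (1%g : G). Proof. exact: chart_at_dom. Qed.

Lemma differentiable_chart_conj x :
  differentiable (c \o conj_by x \o chart_inv c) e.
Proof. by have [_] := mdifferentiable_conj S x (1%g : G); rewrite conj_by1. Qed.

Lemma diff_chart_conj (x : G) w : 'd (c \o conj_by x \o chart_inv c) e w = Ad x w.
Proof. by rewrite AdE /tangent_map conj_by1. Qed.

Lemma near_conj_dom (x : G) :
  \forall v \near e, chart_dom c (conj_by x (chart_inv c v)).
Proof.
apply: (near_chart_inv (P := fun y => chart_dom c (conj_by x y)) dom_e).
have [cx _] := mdifferentiable_conj S x (1%g : G).
have cd : chart_dom c (conj_by x 1%g) by rewrite conj_by1.
exact: (cx (chart_dom c) (open_nbhs_nbhs (conj (chart_dom_open c) cd))).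
Qed.

(* Differentiates [x y = (x y x^-1) x] in [y]. *)
Lemma diff_chart_mul_Ad u w : chart_cod c u ->
  'd mul (e, u) (Ad (chart_inv c u) w, 0) = 'd mul (u, e) (0, w).
Proof.
move=> uc; pose x := chart_inv c u; pose C := c \o conj_by x \o chart_inv c.
have Ce : C e = e by rewrite /C /= chart_at_K conj_by1.
have E : \forall v \near e, mul (u, v) = mul (C v, u).
  apply: filterS (near_conj_dom x) => v vd.
  rewrite /chart_mul /C /= chart_mapK //; congr (c _).
  by rewrite /conj_by mulgVK.
have d1 := differentiable_chart_mul (chart_mul_dom_e_r uc).
have d2 := differentiable_chart_mul (chart_mul_dom_e_l uc).
have dC : differentiable C e := differentiable_chart_conj x.
have dCw : 'd C e w = Ad x w := diff_chart_conj x w.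
exact: (diff_conj_germ S d1 d2 Ce dC dCw E).
Qed.

End AdjointChart.

Section LinearDiff.
Context {R : realType} {K : numFieldType} (S : real_norm R K).
Context {V : normedModType K}.

Lemma diff_linear_comp {m n} {W : normedModType K} (L : {linear 'M[K]_(m, n) -> W})
    (F : V -> 'M[K]_(m, n)) x : differentiable F x ->
  differentiable (fun y => L (F y)) x /\ forall v, 'd (fun y => L (F y)) x v = L ('d F x v).
Proof.
move=> dF; have cL := @mx_linear_continuous _ _ S _ _ _ L.
have dL : differentiable L (F x) by apply: linear_differentiable.
split; first exact: (differentiable_comp dF dL).
move=> v; have D := congr1 (fun f => f v) (diff_comp dF dL).
exact: (etrans D (congr1 (fun f : _ -> W => f ('d F x v)) (diff_lin (F x) cL))).
Qed.

Lemma differentiable_rows {m n} (F : V -> 'M[K]_(m, n)) x :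
  (forall w : 'rV_m, differentiable (fun y => w *m F y) x) -> differentiable F x.
Proof.
move=> dF.
have -> : F = \sum_(i < m) (fun y => delta_mx i (0 : 'I_1) *m (delta_mx 0 i *m F y)).
  apply/funext => y; rewrite fct_sumE; apply/matrixP => i j.
  rewrite summxE (bigD1 i) //= -rowE mxE big_ord1 !mxE !eqxx mul1r.
  rewrite big1 ?addr0 // => k ki; rewrite -rowE mxE big_ord1 !mxE.
  by rewrite eq_sym (negPf ki) mul0r.
apply: differentiable_sum => i.
by have [] := diff_linear_comp (mulmx (delta_mx i (0 : 'I_1))) (dF (delta_mx 0 i)).
Qed.

End LinearDiff.

(** * The bracket: skew-symmetry, equivariance, continuity of Ad *)

Section Bracket.
Context {R : realType} {K : numFieldType} (S : real_norm R K).
Context {n : nat} {G : lieGroupType K n}.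
Local Notation c := (chart_at (1%g : G)).
Local Notation e := (chart_at (1%g : G) 1%g).
Local Notation V := 'rV[K]_n.
Local Notation mul := (@chart_mul K n G).

Let cod_e : chart_cod c e. Proof. exact: chart_at_cod. Qed.
Let dom_e : chart_dom c (1%g : G). Proof. exact: chart_at_dom. Qed.

Definition chart_Ad (u : V) : 'M[K]_n := Ad_mx (chart_inv c u).

Lemma diff_chart_Ad w : differentiable (fun u => w *m chart_Ad u) e /\
  forall xi, 'd (fun u => w *m chart_Ad u) e xi =
    'd ('D_(0, w) mul) (e, e) (xi, 0) - 'd ('D_(w, 0) mul) (e, e) (0, xi).
Proof.
have ce := near_chart_cod dom_e.
apply: (diff_adjoint_germ S).
- by apply: filterS ce => u /chart_mul_dom_e_l /differentiable_chart_mul.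
- by apply: filterS ce => u /chart_mul_dom_e_r /differentiable_chart_mul.
- by move=> v; apply: differentiable_derive_chart_mul; apply: chart_mul_dom_e_r.
- exact: (diff_chart_mul_e1 S).
- exact: (diff_chart_mul_e2 S).
- by rewrite /chart_Ad chart_at_K (Ad_mx1 S).
- by apply: filterS ce => u uc w'; apply: (diff_chart_mul_Ad S).
Qed.

Lemma differentiable_chart_Ad : differentiable chart_Ad e.
Proof. by apply: (differentiable_rows S) => w; have [] := diff_chart_Ad w. Qed.

Lemma bracketE xi w : bracket (G := G) xi w =
  'd ('D_(0, w) mul) (e, e) (xi, 0) - 'd ('D_(w, 0) mul) (e, e) (0, xi).
Proof.
have [_ D] := diff_linear_comp S (mulmx w) differentiable_chart_Ad.
have [_ D2] := diff_chart_Ad w.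
exact: etrans (esym (D xi)) (D2 xi).
Qed.

(** Exchanging the order of derivation in the first term of [bracketE] turns the bracket into X xi
    eta - X eta xi for one mixed second derivative X. *)
Lemma bracket_skew xi eta : bracket (G := G) xi eta = - bracket (G := G) eta xi.
Proof.
have dd v : differentiable ('D_v mul) (e, e).
  by apply: differentiable_derive_chart_mul; apply: chart_mul_dom_e_r.
have near_d : \forall p \near (e, e), differentiable mul p.
  by apply: filterS (near_chart_mul_dom) => p; apply: differentiable_chart_mul.
have H a b : 'd ('D_(0, b) mul) (e, e) (a, 0) = 'd ('D_(a, 0) mul) (e, e) (0, b).
  exact: (schwarz S near_d (dd _) (dd _)).
pose X (a b : V) := 'd ('D_(a, 0) mul) (e, e) (0, b).
have B a b : bracket (G := G) a b = X a b - X b a.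
  exact: (etrans (bracketE a b) (congr1 (fun z => z - X b a) (H a b))).
apply: (etrans (B xi eta)); apply: (etrans _ (congr1 -%R (esym (B eta xi)))).
by move: (X xi eta) (X eta xi) => x y; rewrite opprB.
Qed.

Lemma bracket_linear_l eta : linear (fun xi => bracket (G := G) xi eta).
Proof.
by move=> a u v; rewrite /bracket /ad_mx linearP mulmxDr -scalemxAr.
Qed.

Lemma Ad_mx_conj (g x : G) :
  Ad_mx g *m Ad_mx (conj_by g x) = Ad_mx x *m Ad_mx g.
Proof.
have E : (conj_by g x * g)%g = (g * x)%g by rewrite /conj_by mulgVK.
exact: (etrans (esym (Ad_mxM S _ _)) (etrans (congr1 _ E) (Ad_mxM S _ _))).
Qed.

(** The derivative at x = 1 of Ad(g x g^-1) Ad(g) eta = Ad(g) Ad(x) eta. *)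
Lemma bracket_Ad (g : G) xi eta :
  bracket (G := G) (Ad g xi) (Ad g eta) = Ad g (bracket (G := G) xi eta).
Proof.
have comm (A B D : 'M[K]_n) : A *m B = D *m A -> (eta *m A) *m B = (eta *m D) *m A.
  by move=> ABD; rewrite -!mulmxA ABD.
pose C := c \o conj_by g \o chart_inv c.
have Ce : C e = e by rewrite /C /= chart_at_K conj_by1.
have dC : differentiable C e := differentiable_chart_conj S g.
have dCw : 'd C e xi = Ad g xi := diff_chart_conj g xi.
have E : \forall u \near e, (Ad g eta *m chart_Ad (C u)) = (eta *m chart_Ad u) *m Ad_mx g.
  apply: filterS (near_conj_dom S g) => u ud.
  have CE : chart_inv c (C u) = conj_by g (chart_inv c u) := chart_mapK ud.
  exact: (etrans (congr1 (fun y => Ad g eta *m Ad_mx y) CE) (comm _ _ _ (Ad_mx_conj g _))).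
clearbody C; have [d1 D1] := diff_linear_comp S (mulmx (Ad g eta)) differentiable_chart_Ad.
have [d2 D2] := diff_linear_comp S (mulmx eta) differentiable_chart_Ad.
have [d3 D3] := diff_linear_comp S (mulmxr (Ad_mx g)) d2.
have d1' : differentiable (fun u => Ad g eta *m chart_Ad u) (C e).
  by rewrite Ce; exact: d1.
have D1' := congr1 (fun f => f xi) (diff_comp dC d1').
have [_ D4] := near_eq_diff S E (differentiable_comp dC d1').
have D5 := etrans (congr1 (fun f => f xi) D4) D1'.
have D6 : 'd (fun u => Ad g eta *m chart_Ad u) (C e) ('d C e xi) =
   bracket (G := G) (Ad g xi) (Ad g eta).
  rewrite Ce.
  exact: (etrans (congr1 ('d (fun u => Ad g eta *m chart_Ad u) e) dCw) (D1 (Ad g xi))).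
have D7 := etrans (D3 xi) (congr1 (mulmxr (Ad_mx g)) (D2 xi)).
exact: (etrans (esym D6) (etrans (esym D5) D7)).
Qed.

(** The chart gives continuity at 1; multiplicativity carries it to every g. *)
Lemma Ad_mx_continuous : continuous (Ad_mx : G -> 'M[K]_n).
Proof.
have c1 : {for (1%g : G), continuous (Ad_mx : G -> 'M[K]_n)}.
  have cA := differentiable_continuous differentiable_chart_Ad.
  have cc := chart_map_cont dom_e.
  have H := continuous_comp cc cA.
  move=> P; rewrite /= => PA.
  have PA' : nbhs (chart_Ad e) P by rewrite /chart_Ad chart_at_K.
  have := H _ PA'; have cd := open_nbhs_nbhs (conj (chart_dom_open c) dom_e).
  by move/(filterI cd); apply: filterS => x /= [xd]; rewrite /chart_Ad /= chart_mapK.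
move=> g.
have -> : (Ad_mx : G -> 'M[K]_n) = (mulmxr (Ad_mx g)) \o Ad_mx \o (fun x => (g^-1 * x)%g).
  by apply/funext => x; rewrite /= -(Ad_mxM S) mulVKg.
apply: continuous_comp.
  have [cl _] := smooth2_mdifferentiable_r g^-1%g g (@smooth_mulg _ _ G).
  exact: cl.
rewrite mulVg; apply: (continuous_comp c1).
exact: (mx_linear_continuous S (f := mulmxr (Ad_mx g) : {linear 'M[K]_n -> 'M[K]_n})).
Qed.

End Bracket.

(** * The action of exp y on functionals killed by the square of ad y *)

Section MatrixNorm.
Context {R : realType} {K : numFieldType} (S : real_norm R K).
Local Notation nr := (rnorm S).

Lemma nr_mx_attained {m n} (A : 'M[K]_(m, n)) :
  nr A = 0 \/ exists i j, nr A = nr (A i j : K^o).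
Proof.
have [A0|A0] := eqVneq (mx_norm A) 0; [left|right].
  by apply: (emb_inj (S := S)); rewrite nrE rmorph0.
have [[i j] /= E] := mx_norm_neq0 A0; exists i, j.
by apply: (emb_inj (S := S)); rewrite !nrE.
Qed.

Lemma nr_mulmx {m n p} (A : 'M[K]_(m, n)) (B : 'M[K]_(n, p)) :
  nr (A *m B) <= n%:R * nr A * nr B.
Proof.
have [->|[i [j ->]]] := nr_mx_attained (A *m B).
  by rewrite !mulr_ge0 ?nr_ge0.
rewrite mxE; apply: le_trans (nr_sum _ _ _ _) _.
rewrite -mulrA mulr_natl -[X in _ *+ X](card_ord n) -sumr_const ler_sum // => k _.
by rewrite (nrZ S (A i k) (B k j : K^o)) ler_pM ?nr_ge0 // nr_mx_entry.
Qed.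

Lemma closed_disk_compact (a : K) (r : R) : 0 < r ->
  compact [set x : K | nr (x - a : K^o) <= r].
Proof.
move=> r0; have rK0 : emb S r != 0 by rewrite gt_eqF // emb_gt0.
rewrite (_ : mkset _ = (fun x => a + emb S r * x) @` [set x : K | `|x| <= 1]).
  apply: continuous_compact; last exact: unit_ball_compact S.
  apply: continuous_subspaceT => x.
  have cx := @mulrl_continuous K (emb S r) x.
  exact: (cvgD (cvg_cst a) cx).
apply/seteqP; split=> x /=.
  rewrite -(emb_le S) nrE => xr; exists ((emb S r)^-1 * (x - a)).
    by rewrite normrM normfV emb_norm (gtr0_norm r0) mulrC ler_pdivrMr ?emb_gt0 // mul1r.
  by rewrite mulVKf // addrC subrK.
case=> z z1 <-; rewrite addrAC subrr add0r -(emb_le S) nrE normrM emb_norm (gtr0_norm r0).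
by rewrite ler_piMr // emb_ge0 ltW.
Qed.

Lemma closed_box_compact {n} (a : 'rV[K]_n) (r : R) : 0 < r ->
  compact [set v : 'rV[K]_n | nr (v - a) <= r].
Proof.
move=> r0.
have := @rV_compact K n (fun i => [set x : K | nr (x - a 0 i : K^o) <= r]).
move=> /(_ (fun i => @closed_disk_compact (a 0 i) r r0)).
congr compact; apply/seteqP; split=> v /= vr.
  have [->|[i [j ->]]] := nr_mx_attained (v - a); first exact: ltW.
  by rewrite ord1 !mxE.
by move=> i; apply: le_trans vr; have := nr_mx_entry S (v - a) 0 i; rewrite !mxE.
Qed.

(* [M ^ j b] for a matrix [M = 1 + s A + E] with [E] small and [A ^ 2 b = 0]. *)
Lemma iter_mulmx_shift {n} (A M : 'M[K]_n) (b : 'cV[K]_n) (cA s del : R) (m : nat) :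
  0 <= s -> 0 <= del -> (forall x : 'cV[K]_n, nr (A *m x) <= cA * nr x) ->
  A *m (A *m b) = 0 -> nr (M - 1%:M - emb S s *: A) <= s * del ->
  (cA + n%:R * del) * (m%:R * s) <= 2^-1 ->
  nr (iter m (mulmx M) b - (b + emb S (m%:R * s) *: (A *m b))) <=
    m%:R * s * (2 * n%:R * del * (nr b + m%:R * s * nr (A *m b))).
Proof.
move=> s0 del0 AP Ab EM small.
(* [B] bounds b + (j s) A b for all j <= m, and [Q] is the error allowed per unit of j s. At each
   step one half of s Q is spent on E v and, by [small], the other half on (s A + E) r. *)
set B := nr b + _; set Q := _ * B; set E := M - 1%:M - _ in EM.
have B0 : 0 <= B by rewrite addr_ge0 ?mulr_ge0 ?nr_ge0.
have Q0 : 0 <= Q by rewrite !mulr_ge0.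
have ME : M = 1%:M + emb S s *: A + E by rewrite /E; apply/matrixP => p q; rewrite !mxE; ring.
have EP (x : 'cV[K]_n) : nr (E *m x) <= s * (n%:R * del) * nr x.
  apply: le_trans (nr_mulmx _ _) _; rewrite ler_wpM2r ?nr_ge0 //.
  by rewrite mulrCA ler_wpM2l.
suff H j : (j <= m)%N -> nr (iter j (mulmx M) b - (b + emb S (j%:R * s) *: (A *m b))) <=
    j%:R * s * Q by exact: H.
elim: j => [_|j IH jm].
  by rewrite /= !mul0r rmorph0 scale0r addr0 subrr nr0.
have {}IH := IH (ltnW jm).
set v := b + _ in IH; set r := iter j _ b - v in IH.
have jms : j%:R * s <= m%:R * s by rewrite ler_wpM2r // ler_nat ltnW.
have js0 : 0 <= j%:R * s by rewrite mulr_ge0.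
have vB : nr v <= B.
  apply: le_trans (nrD _ _ _) _; rewrite lerD2l nrZ nr_emb ger0_norm //.
  by rewrite ler_wpM2r ?nr_ge0.
have Av : A *m v = A *m b by rewrite mulmxDr -scalemxAr Ab scaler0 addr0.
have vS : b + emb S (j.+1%:R * s) *: (A *m b) = v + emb S s *: (A *m b).
  by rewrite /v -natr1 mulrDl mul1r rmorphD scalerDl addrA.
have xE : iter j.+1 (mulmx M) b = M *m (v + r) by rewrite /= addrC subrK.
have -> : iter j.+1 (mulmx M) b - (b + emb S (j.+1%:R * s) *: (A *m b)) =
    r + (emb S s *: (A *m r) + E *m r + E *m v).
  rewrite xE vS -Av [X in X *m _]ME mulmxDr !mulmxDl !mul1mx -!scalemxAl.
  move: (A *m v) (A *m r) (E *m v) (E *m r) => x1 x2 x3 x4.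
  by apply/matrixP => p q; rewrite !mxE; ring.
apply: le_trans (nrD _ _ _) _; rewrite -natr1 mulrDl mul1r mulrDl lerD //.
apply: le_trans (nrD _ _ _) _.
apply: le_trans (lerD (nrD _ _ _) (EP _)) _; rewrite nrZ nr_emb ger0_norm //.
apply: le_trans (_ : s * ((cA + n%:R * del) * nr r) + s * (n%:R * del) * B <= _).
  have H2 : s * (n%:R * del) * nr v <= s * (n%:R * del) * B by rewrite ler_wpM2l ?mulr_ge0.
  apply: lerD H2; rewrite mulrDl mulrDr; apply: lerD; first by rewrite ler_wpM2l.
  by rewrite mulrA.
have QE : s * (n%:R * del) * B = s * (2^-1 * Q) by rewrite /Q; field.
rewrite QE -mulrDr ler_wpM2l //.
have : (cA + n%:R * del) * nr r <= 2^-1 * Q; last lra.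
have [c0|c0] := leP 0 (cA + n%:R * del); last first.
  by apply: le_trans (_ : 0 <= _); [have := nr_ge0 S r; nra|rewrite mulr_ge0 // invr_ge0].
apply: le_trans (ler_wpM2l c0 IH) _; rewrite mulrA ler_wpM2r //.
by apply: le_trans small; rewrite ler_wpM2l.
Qed.

End MatrixNorm.

Section AdShift.
Context {R : realType} {K : numFieldType} (S : real_norm R K).
Context {n : nat} {G : lieGroupType K n}.
Local Notation nr := (rnorm S).
Local Notation c := (chart_at (1%g : G)).
Local Notation e := (chart_at (1%g : G) 1%g).
Local Notation V := 'rV[K]_n.

(** Strict differentiability with eps = 1 and v' = e: right multiplication by v moves any nearby u
    by at most 2 |v - e|. *)
Lemma chart_lipschitz : exists2 d : R, 0 < d & forall u v,
  nr (u - e) < d -> nr (v - e) < d ->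
  [/\ chart_mul_dom (G := G) (u, v), chart_cod c u &
      nr (chart_mul (G := G) (u, v) - u) <= 2 * nr (v - e)].
Proof.
have [d d0 dP] := @chart_mul_strict _ _ S n G 1 ltr01.
have e0 : nr (e - e) < d by rewrite subrr nr0.
exists d => // u v ud vd; have [duv H] := dP u v e ud vd e0.
have uc : chart_cod c u by case: duv.
split=> //; rewrite mul1r (chart_mul_e_r uc) in H.
have := nrD S (chart_mul (G := G) (u, v) - u - (v - e)) (v - e).
by rewrite subrK => /le_trans; apply; rewrite mulrDl !mul1r lerD2r.
Qed.

(* Products of [m] elements at distance O(1/m) from the identity remain in a
   fixed neighbourhood of it. *)
Lemma expg_chart (d s : R) (v : V) (m : nat) :
  (forall u v', nr (u - e) < d -> nr (v' - e) < d ->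
    [/\ chart_mul_dom (G := G) (u, v'), chart_cod c u &
        nr (chart_mul (G := G) (u, v') - u) <= 2 * nr (v' - e)]) ->
  0 < d -> nr (v - e) <= s -> s < d -> m%:R * (2 * s) <= d / 2 ->
  exists u, [/\ nr (u - e) <= d / 2 & (chart_inv c v ^+ m)%g = chart_inv c u].
Proof.
move=> dP d0 vs sd small; have s0 : 0 <= s := le_trans (nr_ge0 S _) vs.
have vd : nr (v - e) < d := le_lt_trans vs sd.
suff H j : (j <= m)%N -> exists u,
    nr (u - e) <= j%:R * (2 * s) /\ (chart_inv c v ^+ j)%g = chart_inv c u.
  by have [u [h1 h2]] := H m (leqnn m); exists u; split=> //; apply: le_trans small.
elim: j => [_|j IH jm].
  by exists e; rewrite subrr nr0 mul0r; split=> //; rewrite expg0 chart_at_K.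
have [u [ub uE]] := IH (ltnW jm).
have ud : nr (u - e) < d.
  apply: le_lt_trans ub _; apply: le_lt_trans (_ : d / 2 < d); last first.
    by rewrite ltr_pdivrMr // ltr_pMr // ltr1n.
  by apply: le_trans small; rewrite ler_wpM2r ?mulr_ge0 // ler_nat ltnW.
have [dom _ lip] := dP u v ud vd.
exists (chart_mul (G := G) (u, v)); split.
  apply: le_trans (nr_tri S _ u _) _; rewrite -natr1 mulrDl mul1r addrC lerD //.
  by apply: le_trans lip _; rewrite ler_wpM2l.
by rewrite expgSr uE (chart_inv_mul dom).
Qed.

Lemma Ad_mx_expg (g : G) m (b : 'cV[K]_n) :
  Ad_mx (g ^+ m)%g *m b = iter m (mulmx (Ad_mx g)) b.
Proof.
elim: m => [|m IH]; first by rewrite expg0 (Ad_mx1 S) mul1mx.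
have E := congr1 (mulmx^~ b) (etrans (congr1 Ad_mx (expgSr g m)) (Ad_mxM S (g ^+ m)%g g)).
apply: (etrans E); rewrite /= -mulmxA; exact: (congr1 (mulmx (Ad_mx g)) IH).
Qed.

(** With t = 1 / (m + 1), the element of coordinates e + (t / (p + 1)) y, raised to the power p + 1,
    moves b close to b + t A b for p large. All these powers lie in the compact [Box], whose image
    is closed. Note that m precedes b. *)
Lemma Ad_shift_local (y : V) : exists m : nat, forall b : 'cV[K]_n,
  let A := ad_mx (G := G) y in
  A *m (A *m b) = 0 -> exists g : G, Ad_mx g *m b = b + (m.+1%:R^-1 : K) *: (A *m b).
Proof.
pose A := ad_mx (G := G) y.
have [d d0 dP] := chart_lipschitz.
have [cA cA0 cAP] := mx_linear_bounded S (mulmx A : 'cV[K]_n -> 'cV[K]_n).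
pose Y := nr y + 1; have Y0 : 0 < Y by rewrite ltr_wpDl ?nr_ge0.
pose q := cA + n%:R * Y; have q0 : 0 < q by rewrite ltr_pwDl // mulr_ge0 // ltW.
(* This makes q t <= 1/2, the smallness needed by [iter_mulmx_shift], and 4 t Y <= d, which keeps
   the powers within d / 2 of e in [expg_chart]. *)
pose m := Num.bound (2 * q + 4 * Y / d).
exists m => b /= Ab.
pose t : R := m.+1%:R^-1; have t0 : 0 < t by rewrite invr_gt0.
have tm : t * (2 * q + 4 * Y / d) <= 1.
  rewrite mulrC ler_pdivrMr // mul1r; apply: le_trans (ltW (archi_boundP _)) _.
    by rewrite addr_ge0 ?mulr_ge0 ?invr_ge0 // ltW.
  by rewrite ler_nat.
have tq : q * t <= 2^-1.
  have : 0 <= t * (4 * Y / d) by rewrite !mulr_ge0 ?invr_ge0 // ltW.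
  by move: tm; rewrite mulrDr; lra.
have tY : t * (4 * Y) <= d.
  have : 0 <= t * (2 * q) by rewrite !mulr_ge0 // ltW.
  have : t * (4 * Y / d) = t * (4 * Y) / d by rewrite mulrA.
  move=> E H; move: tm; rewrite mulrDr E => tm.
  have : t * (4 * Y) / d <= 1 by lra.
  by rewrite ler_pdivrMr // mul1r.
pose Box : set V := [set v | nr (v - e) <= d / 2].
have Box_cod v : Box v -> chart_cod c v.
  move=> vB; have vd : nr (v - e) < d.
    by apply: le_lt_trans vB _; rewrite ltr_pdivrMr // ltr_pMr // ltr1n.
  by have [] := dP v v vd vd.
pose I := (fun v => chart_Ad (G := G) v *m b) @` Box.
have Ic : compact I.
  apply: continuous_compact; last by apply: closed_box_compact; rewrite divr_gt0.
  apply: continuous_in_subspaceT => v; rewrite inE => /Box_cod vc.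
  apply: (continuous_comp (f := chart_inv c) (g := fun x => Ad_mx x *m b)).
    exact: chart_inv_cont.
  apply: (continuous_comp (f := (Ad_mx : G -> 'M[K]_n)) (g := mulmxr b)).
    exact: (Ad_mx_continuous S).
  exact: (mx_linear_continuous S (f := mulmxr b : {linear 'M[K]_n -> 'cV[K]_n})).
have Icl : closed I := compact_closed (@norm_hausdorff _ _) Ic.
suff : closure I (b + (m.+1%:R^-1 : K) *: (A *m b)).
  by move/Icl => [v vB <-]; exists (chart_inv c v).
move=> P /(nearP_nr S)[eps eps0 epsP].
pose B := nr b + t * nr (A *m b).
have B0 : 0 <= B by rewrite addr_ge0 ?mulr_ge0 ?nr_ge0 ?(ltW t0).
pose D := t * (2 * n%:R * Y * B) + 1; have D0 : 0 < D.
  by rewrite ltr_wpDl // !mulr_ge0 // ltW.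
(* The error of the iteration is (D - 1) eta, which is below D eta <= eps; eta <= 1 preserves the
   smallness condition. *)
pose eta := Num.min 1 (eps / D).
have eta0 : 0 < eta by rewrite lt_min ltr01 divr_gt0.
have [r r0 rP] := diff_nr S (@differentiable_chart_Ad _ _ S n G) eta0.
(* As t <= 1, this gives s Y < r and s Y < d: the base point lies where the expansion of Ad and the
   Lipschitz bound both hold. *)
pose p := Num.bound (Y / r + Y / d).
pose s := t / p.+1%:R; have s0 : 0 < s by rewrite divr_gt0.
have t1 : t <= 1 by rewrite invf_le1 ?ltr0n // ler1n.
have sp : p.+1%:R * s = t by rewrite mulrC divfK // pnatr_eq0.
have Yp : Y / r + Y / d < p.+1%:R.
  apply: lt_le_trans (archi_boundP _) _; last by rewrite ler_nat.
  by rewrite addr_ge0 // divr_ge0 // ltW.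
have sY (z : R) : 0 < z -> Y / z <= Y / r + Y / d -> s * Y < z.
  move=> z0 /le_lt_trans /(_ Yp); rewrite ltr_pdivrMr // => H.
  rewrite /s mulrAC ltr_pdivrMr ?ltr0n // [z * _]mulrC; apply: le_lt_trans H.
  by rewrite ler_piMl // ltW.
have sYr : s * Y < r by apply: sY => //; rewrite lerDl divr_ge0 // ltW.
have sYd : s * Y < d by apply: sY => //; rewrite lerDr divr_ge0 // ltW.
pose h : V := emb S s *: y; pose v : V := e + h.
have hs : nr h <= s * Y by rewrite nrZ nr_emb gtr0_norm // ler_pM2l // lerDl.
have vh : v - e = h by rewrite /v addrAC subrr add0r.
have EM : nr (chart_Ad (G := G) v - 1%:M - emb S s *: A) <= s * (eta * Y).
  have E1 : chart_Ad (G := G) e = 1%:M by rewrite /chart_Ad chart_at_K (Ad_mx1 S).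
  have E2 : 'd (chart_Ad (G := G)) e h = emb S s *: A := linearZ _ _.
  have := rP h (le_lt_trans hs sYr); rewrite E1 E2 => /le_trans; apply.
  by rewrite mulrCA ler_pM2l.
have [u [uB uE]] : exists u, nr (u - e) <= d / 2 /\ (chart_inv c v ^+ p.+1)%g = chart_inv c u.
  have vs : nr (v - e) <= s * Y by rewrite vh.
  have ps : p.+1%:R * (2 * (s * Y)) <= d / 2.
    have -> : p.+1%:R * (2 * (s * Y)) = 2 * (t * Y) by rewrite -sp; ring.
    by rewrite ler_pdivlMr //; move: tY; lra.
  by have [u [h1 h2]] := expg_chart dP d0 vs sYd ps; exists u.
exists (chart_Ad (G := G) u *m b); split; first by exists u.
have -> : chart_Ad (G := G) u *m b = iter p.+1 (mulmx (chart_Ad (G := G) v)) b.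
  exact: (etrans (congr1 (fun g => Ad_mx g *m b) (esym uE)) (Ad_mx_expg (chart_inv c v) p.+1 b)).
have del0 : 0 <= eta * Y by rewrite mulr_ge0 // ltW.
have e1 : eta <= 1 by rewrite ge_min lexx.
have small : (cA + n%:R * (eta * Y)) * (p.+1%:R * s) <= 2^-1.
  rewrite sp; apply: le_trans tq; rewrite ler_pM2r // lerD2l ler_wpM2l //.
  by rewrite ler_piMl // ltW.
have := iter_mulmx_shift (ltW s0) del0 cAP Ab EM small; rewrite sp.
have -> : (emb S t : K) = m.+1%:R^-1 by rewrite fmorphV rmorph_nat.
move=> bound; apply: epsP; apply: le_lt_trans bound _; rewrite -/B.
apply: lt_le_trans (_ : D * eta <= _); last first.
  by rewrite mulrC -ler_pdivlMr // ge_min lexx orbT.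
have -> : D * eta = t * (2 * n%:R * Y * B) * eta + eta by rewrite /D mulrDl mul1r.
have -> : t * (2 * n%:R * (eta * Y) * B) =
  t * (2 * n%:R * Y * B) * eta by ring.
by rewrite ltrDl.
Qed.

(** As A^2 b = 0, A takes the value A b at every b + x A b. So each local step adds the same vector,
    and m + 1 of them add A b. *)
Lemma Ad_shift (y : V) (b : 'cV[K]_n) : ad_mx (G := G) y *m (ad_mx (G := G) y *m b) = 0 ->
  exists g : G, Ad_mx g *m b = b + ad_mx (G := G) y *m b.
Proof.
move=> Ab; have [m mP] := Ad_shift_local y.
set A := ad_mx (G := G) y in Ab mP *.
suff H j : exists g : G, Ad_mx g *m b = b + (j%:R / m.+1%:R : K) *: (A *m b).
  have [g gE] := H m.+1; exists g.
  have nz : (m.+1%:R : K) != 0 by rewrite pnatr_eq0.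
  by rewrite gE (divff nz) scale1r.
elim: j => [|j [g gE]].
  by exists 1%g; rewrite (Ad_mx1 S) mul1mx mul0r scale0r addr0.
have Ab' : A *m (b + (j%:R / m.+1%:R : K) *: (A *m b)) = A *m b.
  by rewrite mulmxDr -scalemxAr Ab scaler0 addr0.
have [|g' g'E] := mP (b + (j%:R / m.+1%:R : K) *: (A *m b)); first by rewrite Ab'.
exists (g * g')%g.
have E := congr1 (mulmx^~ b) (Ad_mxM S g g').
apply: (etrans E); rewrite -mulmxA; apply: (etrans (congr1 (mulmx (Ad_mx g')) gE)).
apply: (etrans g'E); rewrite Ab' -addrA -scalerDl; congr (_ + _ *: _).
by rewrite -[j.+1%:R]natr1 mulrDl mul1r.
Qed.

End AdShift.

(** * Stability of the Lie algebra of a normal subgroup *)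

Section NormalGerm.
Context {R : realType} {K : numFieldType} (S : real_norm R K).
Context {m n : nat}.
Local Notation nr := (rnorm S).

(* In the application [J] is the derivative of the inclusion of N, [T] that of
   its conjugate by [g], and [k], [l] are coordinates in N of an element of N
   close to 1 and of its conjugate. *)
Lemma range_linear_approx (J T : {linear 'rV[K]_m -> 'rV[K]_n}) (y : 'rV[K]_m) :
  injective J ->
  (forall eps : R, 0 < eps -> exists (sg : K) (k l : 'rV[K]_m),
    [/\ sg != 0, nr (sg *: y - k) <= eps * nr k &
        nr (T k - J l) <= eps * nr k + eps * nr l]) ->
  T y \in limg (linfun J).
Proof.
move=> Jinj approx.
have [J' J'K] : exists J' : {linear 'rV[K]_n -> 'rV[K]_m}, cancel J J'.
  have kJ : lker (linfun J) == 0%VS.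
    apply/eqP/vspaceP => z; rewrite memv0 memv_ker lfunE /=.
    by rewrite -(inj_eq Jinj) linear0.
  by exists (linfun J)^-1%VF => v; have := lker0_lfunK kJ v; rewrite lfunE.
have [a a0 aP] := mx_linear_bounded S J'.
have [b b0 bP] := mx_linear_bounded S J.
have [t t0 tP] := mx_linear_bounded S T.
(* [h] is a linear projection that vanishes exactly on the range of [J]; the goal becomes h (T y) =
   0. *)
pose h v := v - J (J' v).
have hD v w : h (v + w) = h v + h w by rewrite /h linearD linearD; row_ring.
have hZ (x : K) v : h (x *: v) = x *: h v by rewrite /h linearZ linearZ scalerBr.
have hJ v : h (J v) = 0 by rewrite /h J'K subrr.
pose bh := 1 + b * a; have bh0 : 0 < bh by rewrite ltr_pwDl ?mulr_ge0 ?ltW.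
have hP v : nr (h v) <= bh * nr v.
  apply: le_trans (nrB _ _ _) _; rewrite /bh mulrDl mul1r lerD2l -mulrA.
  by apply: le_trans (bP _) _; rewrite ler_pM2l.
suff hTy : h (T y) = 0.
  have -> : T y = linfun J (J' (T y)) by rewrite lfunE /=; apply/subr0_eq.
  by rewrite memv_img ?memvf.
pose Q := bh * (1 + 2 * a * (t + 1)) + bh * t.
have Q0 : 0 <= Q.
  have t1 : 0 <= t + 1 by rewrite addr_ge0 // ltW.
  have a2 : 0 <= 2 * a * (t + 1) by rewrite mulr_ge0 // mulr_ge0 // ltW.
  by rewrite addr_ge0 // mulr_ge0 ?(ltW bh0) ?(ltW t0) // addr_ge0.
pose C := 2 * Q * nr y.
apply: (nr0_eq0 (S := S)); apply/eqP; rewrite eq_le nr_ge0 andbT.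
apply/ler_addgt0Pr => e e0; rewrite add0r.
have C0 : 0 <= C by rewrite mulr_ge0 ?nr_ge0 // mulr_ge0.
(* The bound 1/2 compares k with sg y, the bound (2 a)^-1 absorbs the term in l when l is bounded by
   k, and e / (C + 1) bounds the final error C eps. *)
pose eps := Num.min (Num.min 2^-1 (2 * a)^-1) (e / (C + 1)).
have eps0 : 0 < eps.
  by rewrite !lt_min !invr_gt0 mulr_gt0 // ltr0n /= divr_gt0 // ltr_wpDl.
have eps_half : eps <= 2^-1 by rewrite !ge_min lexx.
have eps_a : a * eps <= 2^-1.
  have -> : 2^-1 = a * (2 * a)^-1 by field; rewrite gt_eqF.
  by rewrite ler_pM2l // !ge_min lexx orbT.
have eps_C : C * eps <= e.
  apply: le_trans (_ : (C + 1) * eps <= _); first by rewrite ler_wpM2r ?lerDl ?ltW.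
  by rewrite mulrC -ler_pdivlMr ?ltr_wpDl // ge_min lexx orbT.
have [sg [k [l [sg0 yk Tk]]]] := approx eps eps0.
have k0 := nr_ge0 S k; have l0 := nr_ge0 S l.
have lb : nr l <= 2 * a * (t + 1) * nr k.
  have H1 : nr l <= a * nr (J l) by rewrite -{1}(J'K l).
  have H2 : nr (J l) <= t * nr k + (eps * nr k + eps * nr l).
    have -> : J l = T k - (T k - J l) by rewrite subKr.
    by apply: le_trans (nrB _ _ _) _; rewrite lerD.
  have H3 : nr l <= a * (t * nr k + (eps * nr k + eps * nr l)).
    by apply: le_trans H1 _; rewrite ler_pM2l.
  have H4 : a * eps * nr l <= 2^-1 * nr l by rewrite ler_wpM2r.
  have H5 : a * (eps * nr k) <= a * nr k.
    by rewrite ler_pM2l // ler_piMl // (le_trans eps_half) // invf_le1 // ler1n.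
  lra.
have kb : nr k <= 2 * (nr (sg : K^o) * nr y).
  have : nr k <= nr (sg *: y) + nr (sg *: y - k).
    by rewrite -[in leLHS](subKr (sg *: y) k) nrB.
  have : eps * nr k <= 2^-1 * nr k by rewrite ler_wpM2r.
  rewrite nrZ; lra.
have H1 : nr (h (T k)) <= bh * (1 + 2 * a * (t + 1)) * (eps * nr k).
  have -> : h (T k) = h (T k - J l) by rewrite hD -scaleN1r hZ hJ scaler0 addr0.
  apply: le_trans (hP _) _; rewrite -mulrA ler_pM2l //.
  apply: le_trans Tk _; rewrite mulrDl mul1r lerD2l mulrCA ler_pM2l //.
have H2 : nr (h (T (sg *: y - k))) <= bh * t * (eps * nr k).
  apply: le_trans (hP _) _; rewrite -mulrA ler_pM2l //.
  by apply: le_trans (tP _) _; rewrite ler_pM2l.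
have sgp : 0 < nr (sg : K^o) by rewrite nr_gt0.
(* All estimates are homogeneous in the size of sg, which therefore cancels however small it is. *)
rewrite -(ler_pM2l sgp) -nrZ.
have -> : sg *: h (T y) = h (T k) + h (T (sg *: y - k)).
  by rewrite -hD -linearD addrC subrK linearZ hZ.
apply: le_trans (nrD _ _ _) _; apply: le_trans (lerD H1 H2) _.
rewrite -mulrDl -/Q.
apply: le_trans (_ : Q * (eps * (2 * (nr (sg : K^o) * nr y))) <= _).
  by rewrite ler_wpM2l // ler_pM2l.
have -> : Q * (eps * (2 * (nr (sg : K^o) * nr y))) = nr (sg : K^o) * (C * eps).
  by rewrite /C; ring.
by rewrite ler_pM2l.
Qed.

End NormalGerm.

(** Choose for each s a basic open set around f s inside the translate f s W. The base is countable,
    so two parameters share the same one. As f is arbitrary, it may be composed with a conjugation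
    whose continuity in the subgroup is unknown. *)
Lemma second_countable_translates (R : realType) (K : numFieldType) (m : nat)
    (H : lieGroupType K m) (f : R -> H) (W : set H) (d : R) :
  nbhs (1%g : H) W -> 0 < d -> exists s s', [/\ 0 < s < d, 0 < s' < d, s != s' &
    W ((f s)^-1 * f s')%g].
Proof.
move=> W1 d0; apply: contrapT => no.
have [B Bc [_ Bb]] := @manifold_second_countable _ _ H.
have bP s : exists b : set H, [/\ B b, b (f s) & b `<=` [set x | W ((f s)^-1 * x)%g]].
  have Wn : nbhs (f s) [set x | W ((f s)^-1 * x)%g].
    have [cl _] := smooth2_mdifferentiable_r (f s)^-1%g (f s) (@smooth_mulg _ _ H).
    by apply: cl; rewrite mulVg.
  by have [b [Bb' bs] bW] := Bb _ _ Wn; exists b.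
have [b {}bP] := choice bP.
apply: (uncountable_interval d0).
have binj : {in [set t : R | 0 < t < d] &, injective b}.
  move=> s s'; rewrite !inE => sd s'd bb; apply: contrapT => ss'.
  apply: no; exists s, s'; split=> //; first exact/eqP.
  have [_ _ bW] := bP s; apply: bW; rewrite bb.
  by have [] := bP s'.
rewrite -(eq_countable (inj_card_eq binj)).
apply: sub_countable Bc; apply: subset_card_le => _ [s _ <-].
by have [] := bP s.
Qed.

Section NormalSubgroup.
Context {R : realType} {K : numFieldType} (S : real_norm R K).
Context {n : nat} {G : lieGroupType K n} (N : lieSubgroup G).
Local Notation nr := (rnorm S).
Local Notation c := (chart_at (1%g : G)).
Local Notation e := (chart_at (1%g : G) 1%g).
Local Notation H := (sub_group N).
Local Notation m := (sub_dim N).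
Local Notation psi := (chart_at (1%g : H)).
Local Notation e' := (chart_at (1%g : H) 1%g).
Local Notation iota := (@sub_incl _ _ _ N).

Lemma sub_incl1 : iota 1%g = 1%g.
Proof.
have E : (iota 1 * iota 1 = iota 1 * 1)%g by rewrite -sub_inclM !mulg1.
exact: mulgI E.
Qed.

Lemma sub_inclV x : iota x^-1%g = (iota x)^-1%g.
Proof. by apply: (mulgI (iota x)); rewrite -sub_inclM !mulgV sub_incl1. Qed.

Lemma normal_conj (hN : normal_subgroup N) g :
  exists f : H -> H, forall x, iota (f x) = conj_by g (iota x).
Proof.
have ex (x : H) : exists y : H, iota y = conj_by g (iota x).
  by have [y _ yx] := hN g x; exists y.
by have [f fP] := choice ex; exists f.
Qed.

Lemma tangent_map_unit (f : H -> G) : f 1%g = 1%g ->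
  tangent_map f 1%g = 'd (c \o f \o chart_inv psi) e'.
Proof. by move=> f1; rewrite /tangent_map f1. Qed.

Lemma mdifferentiable_unit (f : H -> G) : f 1%g = 1%g -> mdifferentiable f 1%g ->
  differentiable (c \o f \o chart_inv psi) e'.
Proof. by move=> f1 [_]; rewrite f1. Qed.

Let J : {linear 'rV[K]_m -> 'rV[K]_n} := 'd (c \o iota \o chart_inv psi) e'.

Let dJ : differentiable (c \o iota \o chart_inv psi) e'.
Proof.
exact: (mdifferentiable_unit sub_incl1 (smooth_mdifferentiable _ (@sub_incl_smooth _ _ _ N))).
Qed.

Let JL : tangent_map iota 1%g = J.
Proof. exact: tangent_map_unit sub_incl1. Qed.

Let JE y : tangent_map iota 1%g y = J y.
Proof. exact: (congr1 (fun L : {linear 'rV[K]_m -> 'rV[K]_n} => L y) JL). Qed.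

Let Jinj : injective J.
Proof.
move=> x y xy; apply: (@sub_incl_immersion _ _ _ N 1%g).
exact: (etrans (JE x) (etrans xy (esym (JE y)))).
Qed.

Let lie_subE : lie_sub N = limg (linfun J).
Proof. exact: (congr1 (fun L : {linear 'rV[K]_m -> 'rV[K]_n} => limg (linfun L)) JL). Qed.

Let mconj g : mdifferentiable (conj_by g \o iota) (1%g : H).
Proof.
apply: (mdifferentiable_comp S).
  exact: smooth_mdifferentiable (@sub_incl_smooth _ _ _ N).
exact: (mdifferentiable_conj S).
Qed.

Let conj_iota1 g : (conj_by g \o iota) 1%g = 1%g.
Proof. by rewrite /= sub_incl1 conj_by1. Qed.

Let T g : {linear 'rV[K]_m -> 'rV[K]_n} := 'd (c \o (conj_by g \o iota) \o chart_inv psi) e'.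

Let dT g : differentiable (c \o (conj_by g \o iota) \o chart_inv psi) e'.
Proof. exact: (mdifferentiable_unit (conj_iota1 g) (mconj g)). Qed.

Let TL g : tangent_map (conj_by g \o iota) 1%g = T g.
Proof. exact: tangent_map_unit (conj_iota1 g). Qed.

Let TE g y : T g y = Ad g (J y).
Proof.
have E := tangent_comp S (smooth_mdifferentiable (1%g : H) (@sub_incl_smooth _ _ _ N))
  (mdifferentiable_conj S g (iota 1%g)) y.
have E1 := congr1 (fun L : {linear 'rV[K]_m -> 'rV[K]_n} => L y) (TL g).
have E2 : tangent_map (conj_by g) (iota 1%g) (tangent_map iota 1%g y) = Ad g (J y).
  by rewrite AdE sub_incl1; exact: (congr1 (tangent_map (conj_by g) 1%g) (JE y)).
exact: (etrans (esym E1) (etrans E E2)).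
Qed.

Let near_ball (r : R) : 0 < r ->
  \forall q \near (1%g : H), chart_dom psi q /\ nr (psi q - e') < r.
Proof.
move=> r0; apply: filterI.
  by apply: open_nbhs_nbhs; split; [exact: chart_dom_open|exact: chart_at_dom].
have rn : nbhs e' [set v | nr (v - e') < r].
  by apply: (proj2 (nearP_nr S e' _)); exists r.
exact: (chart_map_cont (chart_at_dom (1%g : H)) rn).
Qed.

Let near_div (P : set H) : nbhs (1%g : H) P -> exists2 d : R, 0 < d &
  forall v v', nr (v - e') < d -> nr (v' - e') < d ->
    [/\ chart_cod psi v, chart_cod psi v' & P ((chart_inv psi v)^-1 * chart_inv psi v')%g].
Proof.
move=> P1; have [cm _] := @smooth_mulg _ _ H; have [ci _] := @smooth_invg _ _ H.
have Pm : nbhs ((1%g : H) * 1)%g P by rewrite mulg1.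
have [[A B] /= [A1 B1] AB] := cm (1%g, 1%g) P Pm.
have A1' : nbhs (1%g : H) [set x | A x^-1%g] by apply: ci; rewrite invg1.
have ed := chart_at_dom (1%g : H).
have FF := nbhs_filter e'.
have nA := @filterI _ _ FF _ _ (near_chart_cod ed) (near_chart_inv ed A1').
have nB := near_chart_inv ed B1.
have [d d0 dP] := proj1 (nearP_nr S e' _) (@filterI _ _ FF _ _ nA nB).
exists d; first exact: d0.
move=> v v' /dP[[vc vA] _] /dP[[v'c _] v'B]; split; [exact: vc|exact: v'c|].
exact: (AB ((chart_inv psi v)^-1%g, chart_inv psi v') (conj vA v'B)).
Qed.

Lemma Ad_lie_sub (hN : normal_subgroup N) (g : G) z : z \in lie_sub N -> Ad g z \in lie_sub N.
Proof.
rewrite lie_subE => /memv_imgP[y _ ->]; rewrite lfunE -(TE g y).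
apply: (range_linear_approx (S := S)) => [|eps eps0]; first exact: Jinj.
have [f fP] := normal_conj hN g.
have [d d0 dP] := @chart_mul_strict _ _ S m H eps eps0.
have [d1 d10 d1P] := diff_nr S (dT g) eps0.
have [d2 d20 d2P] := diff_nr S dJ eps0.
have d3 : 0 < Num.min d d1 by rewrite lt_min d0.
have [del del0 delP] := near_div (near_ball d3).
pose Y := nr y + 1; have Y0 : 0 < Y by rewrite ltr_wpDl ?nr_ge0.
pose del' := Num.min (del / Y) (d / Y).
have del'0 : 0 < del' by rewrite lt_min !divr_gt0.
pose v t : 'rV[K]_m := e' + emb S t *: y.
have vE t : v t - e' = emb S t *: y by rewrite /v addrAC subrr add0r.
have vB t t' : v t' - v t = emb S (t' - t) *: y by rewrite /v; row_ring.
clearbody v.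
have vb t : 0 < t < del' -> nr (v t - e') < del /\ nr (v t - e') < d.
  move=> /andP[t0]; rewrite /del' lt_min (ltr_pdivlMr _ _ Y0) (ltr_pdivlMr _ _ Y0) => /andP[h1 h2].
  have tb : nr (v t - e') <= t * Y.
    by rewrite (vE t) nrZ nr_emb (gtr0_norm t0) (ler_pM2l t0) lerDl.
  by split; apply: le_lt_trans tb _.
(* Only the quotient [q] of the conjugates needs this choice; the quotient [p] of the points
   themselves is near 1 by [near_div]. *)
have [s [s' [/vb[sb1 sb2] /vb[s'b1 s'b2] ss' Wq]]] :=
  second_countable_translates (fun t => f (chart_inv psi (v t))) (near_ball d20) del'0.
set x := chart_inv psi (v s) in Wq; set x' := chart_inv psi (v s') in Wq.
set q := (_ * _)%g in Wq; have [qd qb] := Wq.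
have [sc s'c [pd]] := delP _ _ sb1 s'b1; rewrite -/x -/x'.
set p := (x^-1 * x')%g; rewrite lt_min => /andP[pb pb1].
have qE : iota q = conj_by g (iota p).
  rewrite /q /p !sub_inclM !sub_inclV !fP /conj_by !invgM invgK !mulgA.
  by rewrite !mulgVK.
(* The multiplier is the parameter difference; k and l are the coordinates of p and of its conjugate
   q, relative to those of 1. *)
exists (emb S (s' - s)), (psi p - e'), (psi q - e'); split.
- by rewrite -(rmorph0 (emb S)) (inj_eq (emb_inj (S := S))) subr_eq0 eq_sym.
- have e0 : nr (e' - e') < d by rewrite subrr nr0.
  (* Since x p = x', strict differentiability at x compares (s' - s) y with the coordinates of p,
     with an error relative to the latter. *)
  have [_] := dP (v s) (psi p) e' sb2 pb e0.
  rewrite (chart_mul_e_r sc).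
  have -> : chart_mul (G := H) (v s, psi p) = v s'.
    exact: (etrans (congr1 (fun z => psi (x * z)%g) (chart_mapK pd))
             (etrans (congr1 psi (mulVKg x x')) (chart_invK s'c))).
  by rewrite vB.
- have close (w1 w2 w3 : 'rV[K]_n) (r1 r2 : R) :
      nr (w3 - e - w1) <= r1 -> nr (w3 - e - w2) <= r2 -> nr (w1 - w2) <= r1 + r2.
    move=> H1 H2; have -> : w1 - w2 = (w3 - e - w2) - (w3 - e - w1) by row_ring.
    by apply: le_trans (nrB _ _ _) _; rewrite addrC; apply: lerD.
  have back (z' : 'rV[K]_m) : e' + (z' - e') = z' by rewrite addrC subrK.
  have E1 := congr1 (fun r => c (conj_by g (iota r)))
    (etrans (congr1 (chart_inv psi) (back (psi p))) (chart_mapK pd)).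
  have E2 := congr1 (fun r => c (iota r))
    (etrans (congr1 (chart_inv psi) (back (psi q))) (chart_mapK qd)).
  have E3 := congr1 (fun r => c (conj_by g (iota r))) (chart_at_K (1%g : H)).
  have E4 := congr1 (fun r => c (iota r)) (chart_at_K (1%g : H)).
  have H1 := d1P (psi p - e') pb1; have H2 := d2P (psi q - e') qb.
  move: H1 H2 E1 E2 E3 E4; rewrite sub_incl1 conj_by1 /= => H1 H2 E1 E2 E3 E4.
  move: H1 H2; rewrite E1 E2 E3 E4 qE.
  exact: close.
Qed.

End NormalSubgroup.

(** * Orbits *)

Lemma linfun_linearE (K : fieldType) (aT rT : vectType K) (f : aT -> rT) :
  linear f -> linfun f =1 f.
Proof.
move=> lf; pose L := GRing.isLinear.Build K aT rT _ f lf.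
exact: (lfunE (HB.pack f L : {linear aT -> rT})).
Qed.

(** Finite-dimensional duality: the annihilator of the kernel of a map is the image of its
    transpose. *)
Lemma col_kernel_image (K : fieldType) n p (C : 'M[K]_(n, p)) (l : 'cV[K]_n) :
  (forall xi : 'rV_n, xi *m C = 0 -> xi *m l = 0) -> exists z, l = C *m z.
Proof.
move=> kerP; have : (l^T <= C^T)%MS.
  rewrite submxE; apply/eqP/trmx_inj; rewrite trmx_mul trmxK trmx0.
  apply/row_matrixP => i; rewrite row_mul row0; apply: kerP.
  have E : (cokermx C^T)^T *m C = 0 by apply: trmx_inj; rewrite trmx_mul trmxK mulmx_coker trmx0.
  by rewrite -row_mul E row0.
by move=> /submxP[z lz]; exists z^T; rewrite -[l]trmxK lz trmx_mul trmxK.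
Qed.

Section Functionals.
Context {K : numFieldType} {n : nat}.
Local Notation V := 'rV[K]_n.
Implicit Types (beta : 'Hom(V, K^o)) (U : {vspace V}).

Definition dual_res U beta : dual U := linfun (fun x : subvs_of U => beta (vsval x)).

Lemma dual_resE U beta x : dual_res U beta x = beta (vsval x).
Proof. by rewrite linfun_linearE // => a u v; rewrite !linearP. Qed.

Lemma dual_res_proj U beta x : x \in U -> dual_res U beta (vsproj U x) = beta x.
Proof. by move=> xU; rewrite dual_resE vsprojK. Qed.

Lemma dual_ext U (mu mu' : dual U) :
  (forall x, x \in U -> mu (vsproj U x) = mu' (vsproj U x)) -> mu = mu'.
Proof.
by move=> E; apply/lfunP => x; rewrite -(vsvalK x); apply: E; apply: subvsP.
Qed.

(** In column form the coadjoint action is left multiplication by [Ad_mx g], to which the matrix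
    results on shifts apply. *)
Definition functional_col beta : 'cV[K]_n := \col_i beta (delta_mx 0 i).

Lemma functional_colE beta xi : beta xi = (xi *m functional_col beta) 0 0.
Proof.
rewrite [in LHS](row_sum_delta xi) linear_sum mxE; apply: eq_bigr => i _.
by rewrite linearZ mxE.
Qed.

Lemma glue_functionals U1 U2 (f1 : dual U1) (f2 : dual U2) :
  (forall x, x \in (U1 :&: U2)%VS -> f1 (vsproj U1 x) = f2 (vsproj U2 x)) ->
  exists beta, dual_res U1 beta = f1 /\ dual_res U2 beta = f2.
Proof.
(* The decomposition along U1 + U2 is a choice; for x in U1 its second component lies in the
   intersection, where f1 and f2 agree, and symmetrically. *)
move=> f12; pose p1 x := addv_pi1 U1 U2 x; pose p2 x := addv_pi2 U1 U2 x.
pose h x : K^o := f1 (vsproj U1 (p1 x)) + f2 (vsproj U2 (p2 x)).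
have lh : linear h.
  by move=> a x y; rewrite /h /p1 /p2 !linearP /= scalerDr addrACA.
have m1 x : p1 x \in U1 by apply: memv_pi1.
have m2 x : p2 x \in U2 by apply: memv_pi2.
have p12 x : x \in (U1 + U2)%VS -> p1 x + p2 x = x by move=> xU; apply: addv_pi1_pi2.
exists (linfun h); split; apply: dual_ext => x xU; rewrite dual_res_proj // linfun_linearE // /h.
  have xx := p12 x (subvP (addvSl U1 U2) _ xU).
  have x2 : p2 x \in (U1 :&: U2)%VS.
    by rewrite memv_cap m2 andbT -[p2 x](addKr (p1 x)) xx rpredD ?rpredN.
  by rewrite -f12 // -linearD -linearD xx.
have xx := p12 x (subvP (addvSr U1 U2) _ xU).
have x1 : p1 x \in (U1 :&: U2)%VS.
  by rewrite memv_cap m1 -[p1 x](addrK (p2 x)) xx rpredB.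
by rewrite f12 // -linearD -linearD xx.
Qed.

End Functionals.

Section Orbits.
Context {R : realType} {K : numFieldType} (S : real_norm R K).
Context {n : nat} {G : lieGroupType K n} (N : lieSubgroup G).
Hypothesis hN : normal_subgroup N.
Local Notation V := 'rV[K]_n.
Local Notation U := (lie_sub N).
Local Notation br := (bracket (G := G)).
Implicit Types (g h : G) (nu : dual (lie_sub N)) (beta : 'Hom(V, K^o)).

(** The component of Ad(x) y along a complement of [U] is constantly 0 in x, hence so is its
    derivative at 1. *)
Lemma bracket_lie_sub xi y : y \in U -> br xi y \in U.
Proof.
move=> yU; pose L : {linear 'M[K]_n -> V} := (\1 - projv U)%VF \o mulmx y.
have [_ D] := diff_linear_comp S L (differentiable_chart_Ad S (G := G)).
have L0 : (fun u => L (chart_Ad (G := G) u)) = cst 0.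
  apply/funext => u; rewrite /L /= add_lfunE opp_lfunE id_lfunE projv_id ?subrr //.
  exact: (Ad_lie_sub S hN (chart_inv (chart_at (1%g : G)) u) yU).
have E0 : L (ad_mx (G := G) xi) = 0.
  by apply: (etrans (esym (D xi))); rewrite L0; exact: (congr1 (fun f => f xi) (diff_cst _ _)).
move: E0; rewrite /L /= add_lfunE opp_lfunE id_lfunE => /subr0_eq E.
by rewrite /bracket E; exact: memv_proj.
Qed.

Lemma Ad_linear g : linear (Ad g).
Proof. by move=> a u v; rewrite /Ad mulmxDl scalemxAl. Qed.

Lemma dual_actE g (U1 U2 : {vspace V}) (tau : dual U1) x :
  dual_act g U2 tau x = tau (vsproj U1 (Ad g (vsval x))).
Proof.
rewrite /dual_act linfun_linearE // => a u v.
by rewrite linearP Ad_linear !linearP.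
Qed.

Lemma dual_act_proj g (U1 U2 : {vspace V}) (tau : dual U1) x : x \in U2 ->
  dual_act g U2 tau (vsproj U2 x) = tau (vsproj U1 (Ad g x)).
Proof. by move=> xU; rewrite dual_actE vsprojK. Qed.

Lemma coadjointE g beta xi : coadjoint g beta xi = beta (Ad g xi).
Proof.
by rewrite /coadjoint linfun_linearE // => a u v; rewrite Ad_linear linearP.
Qed.

Lemma stab_alg_Ad g nu xi : xi \in stab_alg (act g nu) -> Ad g xi \in stab_alg nu.
Proof.
move=> /stab_algP xiP; apply/stab_algP => y yU.
have y'U : Ad g^-1%g y \in U := Ad_lie_sub S hN g^-1%g yU.
have yE : y = Ad g (Ad g^-1%g y).
  exact: (etrans (esym (etrans (congr1 (fun z => Ad z y) (mulgV g)) (Ad1 S y))) (AdM S g g^-1%g y)).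
have := xiP _ y'U; rewrite /act dual_act_proj ?bracket_lie_sub //.
by rewrite {2}yE => <-; congr (nu (vsproj U _)); apply: (bracket_Ad S).
Qed.

End Orbits.

Section OrbitCorrespondence.
Context {R : realType} {K : numFieldType} (S : real_norm R K).
Context {n : nat} {G : lieGroupType K n} (N : lieSubgroup G).
Hypothesis hN : normal_subgroup N.
Local Notation V := 'rV[K]_n.
Local Notation U := (lie_sub N).
Local Notation br := (bracket (G := G)).
Local Notation T := (total_dual N).
Implicit Types (g h : G) (nu : dual (lie_sub N)) (beta : 'Hom(V, K^o)) (t : total_dual N).

Lemma functional_bracket beta (la : 'Hom(V, K^o)) :
  (forall xi, xi \in stab_alg (dual_res U beta) -> la xi = 0) ->
  exists2 y, y \in U & forall xi, la xi = beta (br xi y).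
Proof.
(* Projections of the standard basis span [U], which avoids choosing a basis of it. The kernel of xi
   |-> (beta [xi, p i])_i is then the stabilizer algebra. *)
move=> la0; pose p i := projv U (delta_mx 0 i : V).
have pU i : p i \in U by apply: memv_proj.
pose h xi : V := \row_i beta (br xi (p i)).
have lh : linear h.
  move=> a u v; apply/rowP => i; rewrite !mxE (bracket_linear_l (p i) a u v).
  by rewrite linearP.
pose L := GRing.isLinear.Build K V V _ h lh.
pose C := lin1_mx (HB.pack h L : {linear V -> V}).
have CE xi : xi *m C = h xi by rewrite mul_rV_lin1.
have comb xi (w : V) : \sum_i w 0 i * beta (br xi (p i)) = beta (br xi (projv U w)).
  rewrite [in RHS](row_sum_delta w) linear_sum /bracket mulmx_suml linear_sum.
  by apply: eq_bigr => i _; rewrite linearZ -scalemxAl linearZ.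
have [|z lz] := @col_kernel_image _ _ _ C (functional_col la).
  move=> xi; rewrite CE => h0; apply/matrixP => i j; rewrite !ord1 -functional_colE !mxE.
  apply: la0; apply/stab_algP => y yU; rewrite dual_res_proj ?(bracket_lie_sub S hN) //.
  rewrite -[y](projv_id yU) -comb big1 // => i' _.
  by have /rowP/(_ i') := h0; rewrite !mxE => ->; rewrite mulr0.
exists (projv U z^T) => [|xi]; first exact: memv_proj.
rewrite functional_colE lz mulmxA CE mxE -comb; apply: eq_bigr => i _.
by rewrite !mxE mulrC.
Qed.

Lemma functional_col_inj : injective (@functional_col K n).
Proof. by move=> b1 b2 E; apply/lfunP => xi; rewrite !functional_colE E. Qed.

Lemma coadjoint_col g beta :
  functional_col (coadjoint g beta) = Ad_mx g *m functional_col beta.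
Proof.
apply/colP => i; rewrite mxE coadjointE functional_colE /Ad -mulmxA.
by rewrite -rowE [LHS]mxE.
Qed.

Lemma coadjoint_transitive beta beta' :
  dual_res U beta = dual_res U beta' ->
  (forall xi, xi \in stab_alg (dual_res U beta) -> beta xi = beta' xi) ->
  exists g, coadjoint g beta = beta'.
Proof.
move=> eU eS; pose la := beta' - beta.
have laE xi : la xi = beta' xi - beta xi by rewrite /la add_lfunE opp_lfunE.
have laU x : x \in U -> la x = 0.
  by move=> xU; rewrite laE -!(dual_res_proj _ xU) eU subrr.
have [|y yU yP] := @functional_bracket beta la.
  by move=> xi xiS; rewrite laE eS ?subrr.
(* The sign compensates for moving y from the right slot of the bracket to the left. *)
pose z := - y; have zU : z \in U by rewrite rpredN.
have zP xi : la xi = beta (br z xi).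
  rewrite yP (bracket_skew S) /z; congr (beta _).
  by rewrite -[LHS]/(- (xi *m ad_mx y)) /bracket /ad_mx linearN mulmxN.
have Ab : ad_mx (G := G) z *m functional_col beta = functional_col la.
  apply/colP => i; rewrite [RHS]mxE zP functional_colE /bracket -mulmxA.
  by rewrite -rowE [in RHS]mxE.
have brU xi : br z xi \in U.
  by rewrite (bracket_skew S z xi) rpredN; exact: (bracket_lie_sub S hN).
(* The difference vanishes on n, and [z, g] lies in n since z does. *)
have A0 : ad_mx (G := G) z *m functional_col la = 0.
  apply/colP => i; rewrite [RHS]mxE -(laU _ (brU (delta_mx 0 i))).
  rewrite functional_colE /bracket -mulmxA.
  by rewrite -rowE [in RHS]mxE.
have [|g gE] := @Ad_shift _ _ S _ G z (functional_col beta); first by rewrite Ab.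
exists g; apply: functional_col_inj; rewrite coadjoint_col gE Ab.
by apply/colP => i; rewrite !mxE laE subrKC.
Qed.

Definition dual_pair beta : T :=
  existT _ (dual_res U beta) (dual_res (stab_alg (dual_res U beta)) beta).

Definition total_act g t : T :=
  existT _ (act g (projT1 t)) (dual_act g (stab_alg (act g (projT1 t))) (projT2 t)).

(** Evaluating at vectors of g lets pairs over different but equal nu be compared without transport
    along the equality. *)
Definition total_eval t xi : K^o := projT2 t (vsproj (stab_alg (projT1 t)) xi).

Lemma total_ext t t' : projT1 t = projT1 t' ->
  (forall xi, xi \in stab_alg (projT1 t) -> total_eval t xi = total_eval t' xi) -> t = t'.
Proof.
case: t t' => [nu tau] [nu' tau'] /= E; case: _ / E tau' => tau' H.
by congr existT; apply: dual_ext => x xS; apply: H.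
Qed.

Lemma total_act_eval g t xi : xi \in stab_alg (projT1 (total_act g t)) ->
  total_eval (total_act g t) xi = total_eval t (Ad g xi).
Proof. exact: dual_act_proj. Qed.

Lemma actE g nu y : y \in U -> act g nu (vsproj U y) = nu (vsproj U (Ad g y)).
Proof. exact: dual_act_proj. Qed.

Lemma actM g h nu : act (g * h)%g nu = act h (act g nu).
Proof.
apply: dual_ext => y yU; apply: (etrans (actE (g * h)%g nu yU)).
apply: (etrans (congr1 (fun z => nu (vsproj U z)) (AdM S g h y))).
exact: (esym (etrans (actE h _ yU) (actE g nu (Ad_lie_sub S hN h yU)))).
Qed.

Lemma act1 nu : act 1%g nu = nu.
Proof. by apply: dual_ext => y yU; rewrite actE // (Ad1 S). Qed.

Lemma total_actM g h t : total_act (g * h)%g t = total_act h (total_act g t).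
Proof.
apply: total_ext => [|xi xiS]; first exact: actM.
have xiS' : xi \in stab_alg (projT1 (total_act h (total_act g t))).
  by rewrite /= -actM.
apply: (etrans (total_act_eval xiS)); apply: (etrans (congr1 (total_eval t) (AdM S g h xi))).
exact: (esym (etrans (total_act_eval xiS') (total_act_eval (stab_alg_Ad S hN xiS')))).
Qed.

Lemma total_act1 t : total_act 1%g t = t.
Proof.
apply: total_ext => [|xi xiS]; first exact: act1.
by rewrite total_act_eval // (Ad1 S).
Qed.

Lemma dual_pair_eval beta xi : xi \in stab_alg (dual_res U beta) ->
  total_eval (dual_pair beta) xi = beta xi.
Proof. exact: dual_res_proj. Qed.

Lemma dual_res_coadjoint g beta : dual_res U (coadjoint g beta) = act g (dual_res U beta).
Proof.
apply: dual_ext => y yU.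
by rewrite actE // !dual_res_proj ?(Ad_lie_sub S hN) // coadjointE.
Qed.

Lemma dual_pair_coadjoint g beta :
  dual_pair (coadjoint g beta) = total_act g (dual_pair beta).
Proof.
apply: total_ext => [|xi xiS]; first exact: dual_res_coadjoint.
rewrite dual_pair_eval // coadjointE total_act_eval; last first.
  by rewrite /= -dual_res_coadjoint.
rewrite dual_pair_eval //; apply: (stab_alg_Ad S hN).
by rewrite -dual_res_coadjoint.
Qed.

Lemma dual_pair_orbit beta beta' : dual_pair beta = dual_pair beta' ->
  exists g, coadjoint g beta = beta'.
Proof.
move=> E; have E1 : dual_res U beta = dual_res U beta' := congr1 (@projT1 _ _) E.
apply: coadjoint_transitive => // xi xiS.
by rewrite -dual_pair_eval // E dual_pair_eval // -E1.
Qed.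

Lemma dual_pair_extension beta : extension (projT2 (dual_pair beta)).
Proof.
move=> y; rewrite memv_cap => /andP[yU yS].
by rewrite /= !dual_res_proj.
Qed.

Lemma extension_dual_pair nu (tau : dual (stab_alg nu)) :
  extension tau -> exists beta, dual_pair beta = existT _ nu tau.
Proof.
move=> ext; have [|beta [E1 E2]] := @glue_functionals _ _ _ _ nu tau.
  by move=> x xI; rewrite ext.
exists beta; apply: total_ext => [//|xi xiS].
rewrite dual_pair_eval // /total_eval /= -E2 dual_res_proj //.
by rewrite -E1.
Qed.

End OrbitCorrespondence.

(** * The bijection between bundles and coadjoint orbits *)

Section Correspondence.
Context {R : realType} {K : numFieldType} (S : real_norm R K).
Context {n : nat} {G : lieGroupType K n} (N : lieSubgroup G).
Hypothesis hN : normal_subgroup N.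
Local Notation V := 'rV[K]_n.
Local Notation U := (lie_sub N).
Local Notation dual_pair := (dual_pair N).
Implicit Types (g h : G) (nu : dual (lie_sub N)) (beta : 'Hom(V, K^o)) (t : total_dual N).

Lemma coadjointM g h beta : coadjoint (g * h)%g beta = coadjoint h (coadjoint g beta).
Proof.
apply/lfunP => xi; apply: (etrans (coadjointE _ _ _)).
apply: (etrans (congr1 beta (AdM S g h xi))).
exact: (esym (etrans (coadjointE _ _ _) (coadjointE _ _ _))).
Qed.

Lemma coadjoint1 beta : coadjoint (1%g : G) beta = beta.
Proof. by apply/lfunP => xi; rewrite coadjointE (Ad1 S). Qed.

Lemma total_act_stab nu (tau : dual (stab_alg nu)) h : stab nu h ->
  total_act h (existT _ nu tau) = existT _ nu (dual_act h (stab_alg nu) tau).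
Proof.
move=> hnu; apply: total_ext => [|xi xiS]; first exact: hnu.
apply: (etrans (total_act_eval xiS)); rewrite /= in xiS; rewrite hnu in xiS.
exact: (esym (dual_act_proj h tau xiS)).
Qed.

Lemma existT_dual_inj nu (tau tau' : dual (stab_alg nu)) :
  existT _ nu tau = existT _ nu tau' :> total_dual N -> tau = tau'.
Proof.
by move=> E; apply: dual_ext => xi _; exact: (congr1 (fun t => total_eval t xi) E).
Qed.

Definition orbit_pair beta : set (dual U) * set (total_dual N) :=
  (range (fun g : G => act g (dual_res U beta)), range (fun g : G => total_act g (dual_pair beta))).

Lemma orbit_pair_coadjoint g beta : orbit_pair (coadjoint g beta) = orbit_pair beta.
Proof.
rewrite /orbit_pair (dual_pair_coadjoint S hN) (dual_res_coadjoint S hN).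
congr (_, _); apply/seteqP; split=> _ [h _ <-].
- by exists (g * h)%g; [exact: I|]; exact: (actM S hN).
- exists (g^-1 * h)%g; [exact: I|]; apply: (etrans (esym (actM S hN g _ _))).
  exact: (congr1 (fun z => act z (dual_res U beta)) (mulVKg g h)).
- by exists (g * h)%g; [exact: I|]; exact: (total_actM S hN).
exists (g^-1 * h)%g; [exact: I|]; apply: (etrans (esym (total_actM S hN g _ _))).
exact: (congr1 (fun z => total_act z (dual_pair beta)) (mulVKg g h)).
Qed.

Lemma orbit_bundle_pair beta : orbit_bundle (orbit_pair beta).
Proof.
split.
- by exists (dual_res U beta).
- by move=> _ [g _ <-]; exists g.
- move=> nu [g _]; rewrite -(dual_res_coadjoint S hN) => <-.
  (* Rebasing the orbit at [coadjoint g beta] reduces an arbitrary fibre to the one over the base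
     point. *)
  rewrite -[range (fun g => _)]/(orbit_pair beta).2 -(orbit_pair_coadjoint g).
  move: (coadjoint g beta) => {}beta.
  exists (projT2 (dual_pair beta)); first exact: dual_pair_extension.
  apply/seteqP; split=> tau'.
    case=> h _ hE; have hs : stab (dual_res U beta) h := congr1 (@projT1 _ _) hE.
    exists h => //; apply: existT_dual_inj.
    exact: (etrans (esym (total_act_stab _ hs)) hE).
  by case=> h hs <-; exists h => //; exact: (total_act_stab _ hs).
move=> g nu tau [h _ hE]; exists (h * g)%g; first exact: I.
exact: (etrans (total_actM S hN h g _) (congr1 (total_act g) hE)).
Qed.

Lemma orbit_bundleP BP : orbit_bundle BP <-> exists beta, BP = orbit_pair beta.
Proof.
split=> [|[beta ->]]; last exact: orbit_bundle_pair.
case: BP => B P [[nu0 BE] PB fibP actP].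
have B0 : B nu0 by rewrite BE; exists 1%g; [exact: I|]; exact: (act1 S).
have [tau ext fE] := fibP _ B0.
have [beta bE] := extension_dual_pair ext.
exists beta; have E1 : dual_res U beta = nu0 := congr1 (@projT1 _ _) bE.
rewrite /orbit_pair E1 bE BE; congr (_, _); apply/seteqP; split.
  (* A point over g . nu0 is moved back by g^-1 into the fibre over nu0, which is the single orbit
     of tau under the stabilizer. *)
  move=> t Pt; have := PB _ Pt; rewrite BE => -[g _ gE].
  have Pt' : P (total_act g^-1%g t) by case: t Pt gE => nu tau' Pt _; exact: actP.
  have E2 : projT1 (total_act g^-1%g t) = nu0.
    apply: (etrans (congr1 (act g^-1%g) (esym gE))).
    apply: (etrans (esym (actM S hN g g^-1%g nu0))).
    exact: (etrans (congr1 (fun z => act z nu0) (mulgV g)) (act1 S nu0)).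
  have tE : t = total_act g (total_act g^-1%g t).
    apply: (etrans _ (total_actM S hN g^-1%g g t)).
    exact: (esym (etrans (congr1 (fun z => total_act z t) (mulVg g)) (total_act1 S t))).
  have [tau' tE'] : exists tau', total_act g^-1%g t = existT _ nu0 tau'.
    by case: (total_act g^-1%g t) E2 => nu' tau' /= <-; exists tau'.
  rewrite tE' in Pt' tE; have : fibre P tau' := Pt'.
  rewrite fE => -[h hs hE]; exists (h * g)%g; first exact: I.
  rewrite (total_actM S hN h g) tE; congr (total_act g _).
  by rewrite (total_act_stab tau hs) hE.
move=> _ [g _ <-]; apply: actP.
have : reduced_orbit tau tau.
  exists 1%g; first exact: (act1 S).
  by apply: dual_ext => x xS; rewrite dual_act_proj // (Ad1 S).
by rewrite -fE.
Qed.

(** Equivariance of [dual_pair] gives a union of coadjoint orbits; [dual_pair_orbit], conjugacy of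
    the functionals with the same pair, leaves only one. *)
Lemma orbit_pair_preimage beta :
  [set b | (orbit_pair beta).2 (dual_pair b)] = range ((@coadjoint K n G)^~ beta).
Proof.
apply/seteqP; split=> [b [g _]|_ [g _ <-]].
  rewrite -(dual_pair_coadjoint S hN) => /(dual_pair_orbit S hN)[h <-].
  by exists (g * h)%g; [exact: I|]; exact: coadjointM.
by exists g => //; rewrite -(dual_pair_coadjoint S hN).
Qed.

Lemma orbit_bundle_bij :
  set_bij [set BP : set (dual U) * set (total_dual N) | orbit_bundle BP]
          [set O | coadjoint_orbit (G := G) O]
          (fun BP => [set beta | BP.2 (dual_pair beta)]).
Proof.
split.
- move=> _ /orbit_bundleP[beta ->] /=; exists beta; exact: orbit_pair_preimage.
- move=> BP BP'; rewrite !inE => /orbit_bundleP[b ->] /orbit_bundleP[b' ->].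
  rewrite !orbit_pair_preimage => E.
  (* Equal preimages make b a translate of b', and [orbit_pair] does not change along a coadjoint
     orbit. *)
  have : range ((@coadjoint K n G)^~ b) b by exists 1%g; [exact: I|]; exact: coadjoint1.
  by rewrite E => -[g _ <-]; rewrite orbit_pair_coadjoint.
move=> _ [beta ->]; exists (orbit_pair beta); first exact: orbit_bundle_pair.
exact: orbit_pair_preimage.
Qed.

End Correspondence.

Theorem proposition17 (R : realType) (k : ground) (n : nat)
    (G : lieGroupType (scalars R k) n) (N : lieSubgroup G)
    (hG : connected [set: G])
    (hN : connected [set: N])
    (hnormal : normal_subgroup N) :
  exists f : set (dual (lie_sub N)) * set (total_dual N) ->
             set 'Hom('rV[scalars R k]_n, (scalars R k)^o),
    set_bij [set BP | orbit_bundle BP]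
            [set O | coadjoint_orbit (G := G) O]
            f.
Proof.
by eexists; exact: (orbit_bundle_bij (scalars_real_norm R k) hnormal).
Qed.
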